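(* Let $X$ be a smooth variety over $K$. The exact sequence of $\mathcal{O}_X$-modules $0\to\mathcal{O}_X\to\Omega^\tau_X\to\Omega_{X/K}\to 0$ (first map $f\mapsto f\,\tau e$, second map $\tau f\mapsto df$) makes the sheaf $\Omega^\tau_X$ an extension of $\Omega_{X/K}$ by $\mathcal{O}_X$. Under the natural isomorphism $\mathrm{Ext}^1(\Omega_{X/K},\mathcal{O}_X)\cong H^1(X,\Theta_{X/K})$, where $\Theta_{X/K}$ is the dual sheaf of $\Omega_{X/K}$, the class of this extension corresponds to the Kodaira-Spencer class of $X$ (with respect to $\delta$).
   Context: $(K,\delta)$ is an algebraically closed differential field (a field with a derivation $\delta:K\to K$) containing an element $e$ with $\delta(e)=1$. A variety is an integral, separated $K$-scheme of finite type. For a $K$-algebra $T$, the module of $\tau$-differentials $\Omega^\tau_T$ is the $T$-module generated by symbols $\tau r$, $r\in T$, with relations $\tau(r+s)=\tau r+\tau s$, $\tau(rs)=r\,\tau s+s\,\tau r$ for $r,s\in T$, and $\delta(a)\tau b=\delta(b)\tau a$ for $a,b\in K$. For $X$ smooth, $\Omega^\tau_X$ is the coherent sheaf whose sections on an open affine $\mathrm{Spec}\,T\subseteq X$ are $\Omega^\tau_T$. Kodaira-Spencer class: choose an open affine cover $\{U_i\}$ of $X$ and, on each $U_i$, a derivation $\delta_i:\mathcal{O}_X(U_i)\to\mathcal{O}_X(U_i)$ extending $\delta$ on $K$ (these exist by smoothness). The differences $(\delta_i-\delta_j)|_{U_i\cap U_j}$ are $K$-linear derivations and form a Čech 1-cocycle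 with values in $\Theta_{X/K}$; its class in $H^1(X,\Theta_{X/K})$ is the Kodaira-Spencer class. Convention for the isomorphism $\mathrm{Ext}^1(\Omega_{X/K},\mathcal{O}_X)\cong H^1(X,\Theta_{X/K})$: the extension $0\to\mathcal{O}_X\to\mathcal{E}\to\Omega_{X/K}\to0$ is sent to the class of the cocycle $(s_j-s_i)$, where $s_i:\Omega_{X/K}|_{U_i}\to\mathcal{E}|_{U_i}$ are local splittings and $s_j-s_i$ is regarded as a homomorphism $\Omega_{X/K}\to\mathcal{O}_X$ on $U_i\cap U_j$. *)

(* Defs.v *)
From HB Require Import structures.
From mathcomp Require Import all_boot all_order all_algebra.
From mathcomp Require Import mathcomp_extra boolp classical_sets functions.
From mathcomp Require Import cardinality fsbigop topology.
From mathcomp Require Import -(notations) mpoly.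

Set Implicit Arguments.
Unset Strict Implicit.
Unset Printing Implicit Defensive.

Import GRing.Theory.
Local Open Scope classical_set_scope.
Local Open Scope ring_scope.

(* Rings are [comPzRingType] throughout: the zero ring has to be allowed, as
   it is the ring of sections over the empty set. *)

Section Algebra.
Variables (K : closedFieldType) (T : comPzRingType) (c : K -> T).

Definition derivation (R : comPzRingType) (D : R -> R) : Prop :=
  (forall r s, D (r + s) = D r + D s) /\
  (forall r s, D (r * s) = r * D s + s * D r).

Definition invertible (t : T) : Prop := exists u, t * u = 1.

Definition prime_ideal (p : set T) : Prop :=
  [/\ p 0, forall a b, p a -> p b -> p (a + b),
      forall a b, p b -> p (a * b), ~ p 1 &
      forall a b, p (a * b) -> p a \/ p b].

(* [mpoly.mmap] is not available here since it excludes the zero ring. *)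
Definition peval n (x : 'I_n -> T) (p : mpoly n K) : T :=
  \sum_(m <- msupp p) c (mcoeff m p) * \prod_(i < n) x i ^+ (fun_of_multinom m i).

Definition fg_algebra : Prop :=
  exists n (x : 'I_n -> T), forall t, exists p, t = peval x p.

(* T = K[x_1, ..., x_(k + d)] / (f_1, ..., f_k), where the determinant of
   (df_i / dx_j)_(i, j <= k) is invertible in T. *)
Definition standard_smooth : Prop :=
  exists (k d : nat) (f : 'I_k -> mpoly (k + d)%N K) (x : 'I_(k + d) -> T),
    [/\ forall t, exists p, t = peval x p,
        forall p, peval x p = 0 <->
          exists q : 'I_k -> mpoly (k + d)%N K, p = \sum_i q i * f i &
        invertible
          (\det (\matrix_(i < k, j < k) peval x (mderiv (lshift d j) (f i))))].

(* The free T-module on the symbols [r], r in T, consists of the finitely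
   supported functions T -> T; [symb r] is the symbol of r. *)
Definition symb (r : T) : T -> T^o := fun s => (s == r)%:R.

Definition relations_span (rel : set (T -> T^o)) : set (T -> T^o) :=
  [set a | forall N : set (T -> T^o),
     N 0 -> (forall t u v, N u -> N v -> N (t *: u + v)) ->
     rel `<=` N -> N a].

(* M is the T-module generated by the symbols [tau r], r in T, subject to the
   relations [rel]: the canonical map from the free module to M is onto and its
   kernel is the submodule generated by [rel]. *)
Definition presented (rel : set (T -> T^o)) (M : lmodType T) (tau : T -> M) :=
  (forall m, exists2 a : T -> T^o, finite_set [set s | a s != 0] &
     m = \sum_(s \in [set: T]) a s *: tau s) /\
  (forall a : T -> T^o, finite_set [set s | a s != 0] ->
     (\sum_(s \in [set: T]) a s *: tau s = 0 <-> relations_span rel a)).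

Inductive kahler_rel : set (T -> T^o) :=
| KahlerAdd r s : kahler_rel (symb (r + s) - (symb r + symb s))
| KahlerMul r s : kahler_rel (symb (r * s) - (r *: symb s + s *: symb r))
| KahlerCst a : kahler_rel (symb (c a)).

Inductive tau_rel (delta : K -> K) : set (T -> T^o) :=
| TauAdd r s : tau_rel delta (symb (r + s) - (symb r + symb s))
| TauMul r s : tau_rel delta (symb (r * s) - (r *: symb s + s *: symb r))
| TauCst a b : tau_rel delta
    (c (delta a) *: symb (c b) - c (delta b) *: symb (c a)).

End Algebra.

Record opens (X : topologicalType) :=
  Opens { oset :> set X; open_oset : open oset }.

Definition omem (X : topologicalType) (U : opens X) (x : X) : Prop := oset U x.
Coercion omem : opens >-> Funclass.

Definition opensI (X : topologicalType) (U V : opens X) : opens X :=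
  Opens (openI (open_oset U) (open_oset V)).

(* Topological spaces with a sheaf [reg] of K-algebras, written O below. *)
Record kspace (K : closedFieldType) := KSpace {
  pt :> topologicalType;
  reg : opens pt -> comPzRingType;
  ores : forall U V : opens pt, V `<=` U -> {rmorphism reg U -> reg V};
  kcst : forall U, {rmorphism K -> reg U};
  ores_id : forall (U : opens pt) (h : U `<=` U) s, ores h s = s;
  ores_comp : forall (U V W : opens pt) (hVU : V `<=` U) (hWV : W `<=` V)
    (hWU : W `<=` U) s, ores hWV (ores hVU s) = ores hWU s;
  ores_cst : forall (U V : opens pt) (h : V `<=` U) a,
    ores h (kcst U a) = kcst V a;
  osheaf : forall (U : opens pt) (I : Type) (V : I -> opens pt)
    (hV : forall i, V i `<=` U),
    (forall x, U x -> exists i, V i x) ->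
    forall s : forall i, reg (V i),
    (forall i j (W : opens pt) (hi : W `<=` V i) (hj : W `<=` V j),
       ores hi (s i) = ores hj (s j)) ->
    exists! t : reg U, forall i, ores (hV i) t = s i }.

Section Schemes.
Variables (K : closedFieldType) (X : kspace K).
Implicit Types U V W : opens X.

(* The germ of f at x is a unit of the stalk. *)
Definition unit_at U (f : reg U) (x : X) : Prop :=
  exists V (h : V `<=` U), V x /\ invertible (ores h f).

(* (U, O|U) is isomorphic to Spec T for T = O(U): the canonical map sending x to
   the set of f whose germ at x is not a unit is a bijection from U to the set
   of prime ideals of T, the sets D(f) form a base of the topology of U, and
   O(D(f)) is the localization of T at f. *)
Definition affine U : Prop :=
  [/\ forall x, U x -> prime_ideal [set f : reg U | ~ unit_at f x],
      forall p : set (reg U), prime_ideal p ->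
        exists! x, U x /\ forall f, p f <-> ~ unit_at f x,
      forall V x, V `<=` U -> V x ->
        exists f : reg U, unit_at f x /\
          forall y, U y -> unit_at f y -> V y &
      forall (f : reg U) V (h : V `<=` U),
        (forall y, V y <-> U y /\ unit_at f y) ->
        [/\ invertible (ores h f),
            forall t : reg V, exists n a, ores h a = t * ores h f ^+ n &
            forall a : reg U, ores h a = 0 -> exists n, f ^+ n * a = 0]].

Definition is_scheme : Prop := forall x : X, exists2 U : opens X, U x & affine U.

Definition integral_scheme : Prop :=
  (exists x : X, True) /\
  forall U, (exists x, U x) ->
    (1 : reg U) <> 0 /\ forall a b : reg U, a * b = 0 -> a = 0 \/ b = 0.

Definition finite_type : Prop :=
  exists n (U : 'I_n -> opens X),
    (forall x, exists i, U i x) /\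
    forall i, affine (U i) /\ fg_algebra (kcst (U i)).

Definition smooth_scheme : Prop :=
  forall x : X, exists2 U : opens X, U x &
    affine U /\ standard_smooth (kcst U).

End Schemes.

(* Morphisms of spaces with sheaves of K-algebras whose maps on stalks are
   local.  The comorphism is given as maps O_Y(U) -> O_X(V) for all opens
   V of X and U of Y with f(V) contained in U, which avoids transport along
   equalities of preimages. *)
Record kmor (K : closedFieldType) (X Y : kspace K) := KMor {
  fn :> X -> Y;
  com : forall (V : opens X) (U : opens Y),
    (forall x, V x -> U (fn x)) -> {rmorphism reg U -> reg V};
  fn_cont : continuous fn;
  com_res : forall (V V' : opens X) (U U' : opens Y)
    (h : forall x, V x -> U (fn x)) (h' : forall x, V' x -> U' (fn x))
    (hV : V' `<=` V) (hU : U' `<=` U) s,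
    ores hV (com h s) = com h' (ores hU s);
  com_cst : forall (V : opens X) (U : opens Y)
    (h : forall x, V x -> U (fn x)) a, com h (kcst U a) = kcst V a;
  com_local : forall (V : opens X) (U : opens Y)
    (h : forall x, V x -> U (fn x)) s x,
    V x -> unit_at (com h s) x -> unit_at s (fn x) }.

Section Separated.
Variable K : closedFieldType.

Definition kmor_eq (X Y : kspace K) (f g : kmor X Y) : Prop :=
  (forall x, f x = g x) /\
  forall (V : opens X) (U : opens Y) (hf : forall x, V x -> U (f x))
    (hg : forall x, V x -> U (g x)) s, com hf s = com hg s.

(* f = p \o h *)
Definition is_comp (X Y Z : kspace K) (p : kmor Y Z) (h : kmor X Y)
    (f : kmor X Z) : Prop :=
  (forall x, f x = p (h x)) /\
  forall (V : opens X) (W : opens Y) (U : opens Z)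
    (hf : forall x, V x -> U (f x)) (hh : forall x, V x -> W (h x))
    (hp : forall y, W y -> U (p y)) s, com hf s = com hh (com hp s).

Definition is_id (X : kspace K) (f : kmor X X) : Prop :=
  (forall x, f x = x) /\
  forall (V U : opens X) (hf : forall x, V x -> U (f x)) (h : V `<=` U) s,
    com hf s = ores h s.

(* P, p1, p2 is the product of X with itself in the category of K-schemes. *)
Definition is_square (X P : kspace K) (p1 p2 : kmor P X) : Prop :=
  is_scheme P /\
  forall Z : kspace K, is_scheme Z -> forall f1 f2 : kmor Z X,
    (exists h : kmor Z P, is_comp p1 h f1 /\ is_comp p2 h f2) /\
    (forall h h' : kmor Z P, is_comp p1 h f1 -> is_comp p2 h f2 ->
       is_comp p1 h' f1 -> is_comp p2 h' f2 -> kmor_eq h h').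

(* f is a homeomorphism onto a closed subset, and the sheaf map
   O_Y -> f_* O_X is surjective. *)
Definition closed_immersion (X Y : kspace K) (f : kmor X Y) : Prop :=
  [/\ injective f, forall C : set X, closed C -> closed (f @` C) &
      forall (W : opens Y) (V : opens X), (forall x, V x <-> W (f x)) ->
      forall (t : reg V) (y : Y), W y ->
      exists (W' : opens Y) (V' : opens X) (hV : V' `<=` V)
        (hf : forall x, V' x -> W' (f x)) (s : reg W'),
        [/\ W' `<=` W, W' y, forall x, W' (f x) -> V' x &
            com hf s = ores hV t]].

Definition separated_scheme (X : kspace K) : Prop :=
  exists (P : kspace K) (p1 p2 : kmor P X) (id : kmor X X) (diag : kmor X P),
    [/\ is_square p1 p2, is_id id, is_comp p1 diag id, is_comp p2 diag id &
        closed_immersion diag].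

Definition variety (X : kspace K) : Prop :=
  [/\ is_scheme X, integral_scheme X, separated_scheme X & finite_type X].

End Separated.

Record omodule (K : closedFieldType) (X : kspace K) := OModule {
  sec :> forall U : opens X, lmodType (reg U);
  mres : forall U V : opens X, V `<=` U -> {additive sec U -> sec V};
  mres_scale : forall (U V : opens X) (h : V `<=` U) (a : reg U) (m : sec U),
    mres h (a *: m) = ores h a *: mres h m;
  mres_id : forall (U : opens X) (h : U `<=` U) m, mres h m = m;
  mres_comp : forall (U V W : opens X) (hVU : V `<=` U) (hWV : W `<=` V)
    (hWU : W `<=` U) m, mres hWV (mres hVU m) = mres hWU m;
  msheaf : forall (U : opens X) (I : Type) (V : I -> opens X)
    (hV : forall i, V i `<=` U),
    (forall x, U x -> exists i, V i x) ->
    forall s : forall i, sec (V i),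
    (forall i j (W : opens X) (hi : W `<=` V i) (hj : W `<=` V j),
       mres hi (s i) = mres hj (s j)) ->
    exists! t : sec U, forall i, mres (hV i) t = s i }.

Arguments mres {K X F U V} h : rename.

Section StructureModule.
Variables (K : closedFieldType) (X : kspace K).

Definition omod1_res (U V : opens X) (h : V `<=` U) :
  {additive (reg U)^o -> (reg V)^o} := ores h.

Lemma omod1_scale (U V : opens X) (h : V `<=` U) (a : reg U) (m : (reg U)^o) :
  omod1_res h (a *: m) = ores h a *: omod1_res h m.
Proof. exact: rmorphM. Qed.

(* O_X as a module over itself. *)
Definition omod1 : omodule X :=
  @OModule K X (fun U => (reg U)^o : lmodType (reg U)) omod1_res omod1_scale
    (@ores_id K X) (@ores_comp K X) (@osheaf K X).

End StructureModule.

(* Morphisms F|U -> G|U of sheaves of modules over O_X|U. *)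
Record lochom (K : closedFieldType) (X : kspace K) (F G : omodule X)
    (U : opens X) := LocHom {
  lh :> forall V : opens X, V `<=` U -> F V -> G V;
  lh_linear : forall (V : opens X) (h : V `<=` U) (a : reg V) (m n : F V),
    lh h (a *: m + n) = a *: lh h m + lh h n;
  lh_res : forall (V W : opens X) (hVU : V `<=` U) (hWV : W `<=` V) (hWU : W `<=` U) m,
    mres hWV (lh hVU m) = lh hWU (mres hWV m) }.

Section LocHom.
Variables (K : closedFieldType) (X : kspace K) (F G : omodule X).
Implicit Types U V W : opens X.

Lemma lochomP U (f g : lochom F G U) :
  (forall (V : opens X) (h : V `<=` U) m, f V h m = g V h m) -> f = g.
Proof.
case: f g => [f f1 f2] [g g1 g2] /= fg.
have e : f = g.
  by apply: functional_extensionality_dep => V; do 2![apply: funext => ?].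
by case: _ / e in g1 g2 fg *; congr LocHom; exact: Prop_irrelevance.
Qed.

Program Definition lochom0 U : lochom F G U := @LocHom _ _ _ _ U
  (fun V h m => 0) _ _.
Next Obligation. by move=> U V h a m n /=; rewrite scaler0 addr0. Qed.
Next Obligation. by move=> * /=; rewrite raddf0. Qed.

Program Definition lochom_opp U (f : lochom F G U) := @LocHom _ _ F G U
  (fun V h m => - f V h m) _ _.
Next Obligation.
by move=> U f V h a m n /=; rewrite lh_linear opprD scalerN.
Qed.
Next Obligation.
by move=> U f V W h1 h2 h3 m /=; rewrite raddfN (lh_res f h1 h2 h3).
Qed.

Program Definition lochom_add U (f g : lochom F G U) := @LocHom _ _ F G U
  (fun V h m => f V h m + g V h m) _ _.
Next Obligation.
by move=> U f g V h a m n /=; rewrite !lh_linear addrACA scalerDr.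
Qed.
Next Obligation.
by move=> U f g V W h1 h2 h3 m /=; rewrite raddfD !(lh_res _ h1 h2 h3).
Qed.

HB.instance Definition _ U := gen_eqMixin (lochom F G U).
HB.instance Definition _ U := gen_choiceMixin (lochom F G U).

Lemma lochom_addA U : associative (@lochom_add U).
Proof. by move=> f g k; apply: lochomP => V h m /=; rewrite addrA. Qed.
Lemma lochom_addC U : commutative (@lochom_add U).
Proof. by move=> f g; apply: lochomP => V h m /=; rewrite addrC. Qed.
Lemma lochom_add0 U : left_id (lochom0 U) (@lochom_add U).
Proof. by move=> f; apply: lochomP => V h m /=; rewrite add0r. Qed.
Lemma lochom_addN U : left_inverse (lochom0 U) (@lochom_opp U) (@lochom_add U).
Proof. by move=> f; apply: lochomP => V h m /=; rewrite addNr. Qed.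

HB.instance Definition _ U := GRing.isZmodule.Build (lochom F G U)
  (@lochom_addA U) (@lochom_addC U) (@lochom_add0 U) (@lochom_addN U).

Program Definition lochom_res_fun U U' (h : U' `<=` U) (f : lochom F G U) :=
  @LocHom _ _ F G U' (fun V hV m => f V (subset_trans hV h) m) _ _.
Next Obligation. by move=> *; exact: lh_linear. Qed.
Next Obligation. by move=> *; exact: lh_res. Qed.

Lemma lochom_res_additive U U' (h : U' `<=` U) :
  additive (lochom_res_fun h).
Proof. by move=> f g; apply: lochomP => V hV m. Qed.

HB.instance Definition _ U U' (h : U' `<=` U) :=
  GRing.isAdditive.Build _ _ (lochom_res_fun h) (lochom_res_additive h).

Definition lochom_res U U' (h : U' `<=` U) :
  {additive lochom F G U -> lochom F G U'} := lochom_res_fun h.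

Lemma lochom_res_id U (h : U `<=` U) f : lochom_res h f = f.
Proof.
by apply: lochomP => V hV m /=; congr (f V _ m); exact: Prop_irrelevance.
Qed.

Lemma lochom_res_comp U V W (hVU : V `<=` U) (hWV : W `<=` V) (hWU : W `<=` U) f :
  lochom_res hWV (lochom_res hVU f) = lochom_res hWU f.
Proof.
by apply: lochomP => V' hV m /=; congr (f V' _ m); exact: Prop_irrelevance.
Qed.

End LocHom.

Record abpresheaf (X : topologicalType) := AbPresheaf {
  asec :> opens X -> zmodType;
  ares : forall U V : opens X, V `<=` U -> {additive asec U -> asec V};
  ares_id : forall (U : opens X) (h : U `<=` U) s, ares h s = s;
  ares_comp : forall (U V W : opens X) (hVU : V `<=` U) (hWV : W `<=` V)
    (hWU : W `<=` U) s, ares hWV (ares hVU s) = ares hWU s }.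

Arguments ares {X F U V} h : rename.

(* Only the presheaf structure of the sheaf Hom(F, G) is needed for Cech
   cohomology. *)
Definition sheafHom (K : closedFieldType) (X : kspace K) (F G : omodule X) :
    abpresheaf X :=
  @AbPresheaf X (fun U => lochom F G U : zmodType) (@lochom_res K X F G)
    (@lochom_res_id K X F G) (@lochom_res_comp K X F G).

Definition dual_sheaf (K : closedFieldType) (X : kspace K) (F : omodule X) :
  abpresheaf X := sheafHom F (omod1 X).

Section Cech.
Variables (X : topologicalType) (F : abpresheaf X).
Implicit Types U V W : opens X.

Record open_cover := Cover {
  cidx : Type;
  cset :> cidx -> opens X;
  cset_cover : forall x : X, exists i, cset i x }.

Record cocycle := Cocycle {
  cov :> open_cover;
  coch : forall i j : cidx cov, F (opensI (cov i) (cov j));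
  coch_cocycle : forall (i j k : cidx cov) W
    (hij : W `<=` opensI (cov i) (cov j)) (hjk : W `<=` opensI (cov j) (cov k))
    (hik : W `<=` opensI (cov i) (cov k)),
    ares hij (coch i j) + ares hjk (coch j k) = ares hik (coch i k) }.

(* The cocycles z and z' (on possibly different covers) have the same image in
   the colimit of the groups H^1(W, F) over all open covers W: their
   restrictions to some common refinement differ by a coboundary. *)
Definition cohomologous (z z' : cocycle) : Prop :=
  exists (W : open_cover) (r : cidx W -> cidx z) (r' : cidx W -> cidx z')
    (h : forall k, F (W k)),
    [/\ forall k, W k `<=` z (r k), forall k, W k `<=` z' (r' k) &
        forall k l (e : opensI (W k) (W l) `<=` opensI (z (r k)) (z (r l)))
          (e' : opensI (W k) (W l) `<=` opensI (z' (r' k)) (z' (r' l)))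
          (ek : opensI (W k) (W l) `<=` W k) (el : opensI (W k) (W l) `<=` W l),
          ares e' (coch (r' k) (r' l)) - ares e (coch (r k) (r l)) =
          ares el (h l) - ares ek (h k)].

Definition is_H1 (S : cocycle -> Prop) : Prop := exists z, S = cohomologous z.

(* H^1(X, F), as the set of cohomology classes of Cech 1-cocycles; in degree 1
   it agrees with derived functor cohomology when F is a sheaf. *)
Definition H1 := {S : cocycle -> Prop | is_H1 S}.

Definition H1_class (z : cocycle) : H1 :=
  exist is_H1 (cohomologous z) (ex_intro _ z erefl).

End Cech.

Section Extensions.
Variables (K : closedFieldType) (X : kspace K).

Record omor (F G : omodule X) := OMor {
  om :> forall U, F U -> G U;
  om_linear : forall U (a : reg U) (m n : F U), om (a *: m + n) = a *: om m + om n;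
  om_res : forall (U V : opens X) (h : V `<=` U) m,
    mres h (om m) = om (mres h m) }.

(* 0 -> F -> E -> G -> 0 is an exact sequence of sheaves. *)
Definition short_exact (F E G : omodule X) (i : omor F E) (p : omor E G) : Prop :=
  [/\ forall U (m : F U), i U m = 0 -> m = 0,
      forall U (m : F U), p U (i U m) = 0,
      forall U (n : E U), p U n = 0 -> forall x, U x ->
        exists (V : opens X) (h : V `<=` U) (m : F V),
          V x /\ i V m = mres h n &
      forall U (q : G U) x, U x ->
        exists (V : opens X) (h : V `<=` U) (n : E V),
          V x /\ p V n = mres h q].

Record extension (G F : omodule X) := Extension {
  emid : omodule X;
  einj : omor F emid;
  eprj : omor emid G;
  e_exact : short_exact einj eprj }.

Definition ext_equiv (G F : omodule X) (E E' : extension G F) : Prop :=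
  exists f : omor (emid E) (emid E'),
    [/\ forall U, bijective (f U), forall U m, f U (einj E U m) = einj E' U m &
        forall U n, eprj E' U (f U n) = eprj E U n].

Definition is_Ext1 (G F : omodule X) (S : extension G F -> Prop) : Prop :=
  exists E, S = ext_equiv E.

(* Ext^1(G, F), as the set of equivalence classes of extensions of G by F. *)
Definition Ext1 (G F : omodule X) := {S : extension G F -> Prop | is_Ext1 S}.

Definition Ext1_class (G F : omodule X) (E : extension G F) : Ext1 G F :=
  exist (@is_Ext1 G F) (ext_equiv E) (ex_intro _ E erefl).

(* z is the cocycle (s_j - s_i) of some local splittings s_i of E. *)
Definition splitting_cocycle (G F : omodule X) (E : extension G F)
    (z : cocycle (sheafHom G F)) : Prop :=
  exists s : forall i : cidx z, lochom G (emid E) (z i),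
    (forall i (V : opens X) (h : V `<=` z i) m, eprj E V (s i V h m) = m) /\
    forall i j (V : opens X) (h : V `<=` opensI (z i) (z j))
      (hi : V `<=` z i) (hj : V `<=` z j) m,
      einj E V ((coch i j : lochom G F _) V h m) = s j V hj m - s i V hi m.

(* The graph of the natural isomorphism Ext^1(G, O_X) ~ H^1(X, G^dual_sheaf), for G
   locally free. *)
Definition Ext1_to_H1 (G : omodule X) (xi : Ext1 G (omod1 X))
    (kappa : H1 (dual_sheaf G)) : Prop :=
  exists E z, [/\ sval xi E, splitting_cocycle E z & kappa = H1_class z].

End Extensions.

Section Differentials.
Variables (K : closedFieldType) (delta : K -> K) (X : kspace K).

(* (Om, d) is the sheaf Omega_{X/K} with its universal derivation. *)
Definition is_Omega (Om : omodule X) (d : forall U : opens X, reg U -> Om U) :=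
  (forall (U V : opens X) (h : V `<=` U) r, mres h (d U r) = d V (ores h r)) /\
  forall U, affine U -> presented (kahler_rel (kcst U)) (d U).

(* (Om, tau) is the sheaf Omega^tau_X. *)
Definition is_Omega_tau (Om : omodule X)
    (tau : forall U : opens X, reg U -> Om U) :=
  (forall (U V : opens X) (h : V `<=` U) r,
     mres h (tau U r) = tau V (ores h r)) /\
  forall U, affine U -> presented (tau_rel (kcst U) delta) (tau U).

Definition extends_delta (U : opens X) (D : reg U -> reg U) : Prop :=
  derivation D /\ forall a, D (kcst U a) = kcst U (delta a).

Variable Om : omodule X.

(* z is the cocycle of the differences (delta_i - delta_j) on U_i :&: U_j, for
   derivations delta_i of O(U_i) extending delta, U_i affine.  The restriction
   of delta_i to an open V of U_i is the derivation Di of O(V) compatible with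
   it, and a K-linear derivation of O corresponds to a homomorphism from Om to
   O by composition with d. *)
Definition Kodaira_Spencer_cocycle (d : forall U : opens X, reg U -> Om U)
    (z : cocycle (dual_sheaf Om)) : Prop :=
  (forall i, affine (z i)) /\
  exists2 D : forall i, reg (z i) -> reg (z i), (forall i, extends_delta (D i)) &
    forall i j (V : opens X) (h : V `<=` opensI (z i) (z j))
      (hi : V `<=` z i) (hj : V `<=` z j),
    exists Di Dj : reg V -> reg V,
      [/\ extends_delta Di /\ forall r, Di (ores hi r) = ores hi (D i r),
          extends_delta Dj /\ forall r, Dj (ores hj r) = ores hj (D j r) &
          forall r, (coch i j : lochom Om (omod1 X) _) V h (d V r) =
                    Di r - Dj r].

Definition is_Kodaira_Spencer_class (d : forall U : opens X, reg U -> Om U)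
    (kappa : H1 (dual_sheaf Om)) : Prop :=
  exists2 z, Kodaira_Spencer_cocycle d z & kappa = H1_class z.

End Differentials.

(* Main.v *)
Require Import Defs.
From HB Require Import structures.
From mathcomp Require Import -(notations) mpoly.
From mathcomp Require Import all_boot all_order all_algebra finmap.
From mathcomp Require Import boolp classical_sets functions.
From mathcomp Require Import cardinality fsbigop topology.
From mathcomp Require Import ring.

(** A derivation D of the structure sheaf over an open set U that extends delta
    splits the sequence over U: it induces a retraction tau r |-> D r of the
    inclusion f |-> f tau e, because D e = 1, and a section
    dr |-> tau r - D(r) tau e of the projection, because tau a = delta(a) tau e
    for constants a ([tau_retraction], [tau_section], [tau_decomposition]).
    On a smooth variety such derivations exist locally, so the sequence is exact
    ([tau_short_exact]).  If s_i is the section defined by D_i, then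
    (s_j - s_i)(dr) = (D_i - D_j)(r) tau e: the cocycle of these splittings is
    literally a Kodaira-Spencer cocycle ([smooth_patch_cocycle_splitting]).

    The rest makes this meaningful.  Derivations extending delta exist on a
    standard smooth algebra because the invertible Jacobian lets one solve for
    the values on the coordinates ([smooth_derivation]).  On an integral scheme a
    derivation of O(U), U affine, extends uniquely to all smaller open sets, since
    their sections are fractions of elements of O(U) ([derivation_spread]).  The
    two sheaves of differentials are described by generators and relations over
    affine opens only, and the universal property is globalized by gluing
    ([lochom_lift], [lochom_ext]), using that affine opens form a base
    ([affine_base]).  Finally, neither class depends on the choices: being
    cohomologous is an equivalence relation ([cohomologous_trans]), two families of
    splittings of equivalent extensions differ by a cochain
    ([splitting_cocycle_unique]), and so do two families of derivations
    ([difference_cocycle_unique]). *)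

Set Implicit Arguments.
Unset Strict Implicit.
Unset Printing Implicit Defensive.

Import GRing.Theory.
Local Open Scope classical_set_scope.
Local Open Scope ring_scope.

(** * Modules given by generators and relations *)

Section LinComb.
Variables (T : comPzRingType) (G : lmodType T) (E : T -> G).

Definition fsupported (a : T -> T^o) := finite_set [set s | a s != 0].

Definition lincomb (a : T -> T^o) : G := \sum_(s \in [set: T]) a s *: E s.

Lemma fsupported_symb r : fsupported (@symb T r).
Proof.
apply: (@sub_finite_set _ _ [set r]); last exact: finite_set1.
by move=> s /=; rewrite /symb; case: (eqVneq s r) => //; rewrite eqxx.
Qed.

Lemma fsupported0 : fsupported (0 : T -> T^o).
Proof.
by apply: (@sub_finite_set _ _ set0) => //= s; rewrite /= eqxx.
Qed.

Lemma fsupportedP t (u v : T -> T^o) :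
  fsupported u -> fsupported v -> fsupported (t *: u + v).
Proof.
move=> fu fv; apply: (@sub_finite_set _ _ ([set s | u s != 0] `|` [set s | v s != 0])).
  move=> s /= nz; case: (eqVneq (u s) 0) => [u0|]; last by left.
  right; apply: contraNneq nz => v0.
  have -> : (t *: u + v) s = t *: u s + v s by [].
  by rewrite u0 v0 scaler0 addr0.
by rewrite finite_setU.
Qed.

Lemma lincombP t (u v : T -> T^o) : fsupported u -> fsupported v ->
  lincomb (t *: u + v) = t *: lincomb u + lincomb v.
Proof.
move=> fu fv; pose A := fset_set ([set s | u s != 0] `|` [set s | v s != 0]).
have fA : finite_set ([set s | u s != 0] `|` [set s | v s != 0]).
  by rewrite finite_setU.
have out (w : T -> T^o) : (forall s, s \notin A -> w s = 0) ->
    lincomb w = \sum_(s <- A) w s *: E s.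
  by move=> w0; apply: fsbigTE => s /w0 ->; rewrite scale0r.
have zu s : s \notin A -> u s = 0.
  rewrite in_fset_set // notin_setE /= => h; apply/eqP; apply/negP => /negP n.
  by apply: h; left.
have zv s : s \notin A -> v s = 0.
  rewrite in_fset_set // notin_setE /= => h; apply/eqP; apply/negP => /negP n.
  by apply: h; right.
have zw s : s \notin A -> (t *: u + v) s = 0.
  move=> h; have -> : (t *: u + v) s = t *: u s + v s by [].
  by rewrite zu // zv // scaler0 addr0.
rewrite !out // scaler_sumr -big_split /=; apply: eq_bigr => s _.
have -> : (t *: u + v) s = t *: u s + v s by [].
by rewrite scalerDl scalerA.
Qed.

Lemma lincomb_symb r : lincomb (@symb T r) = E r.
Proof.
have -> : lincomb (symb r) = \sum_(s <- [fset r]%fset) symb r s *: E s.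
  apply: fsbigTE => s; rewrite inE => /negPf h.
  by rewrite /symb h scale0r.
by rewrite big_seq_fset1 /symb eqxx scale1r.
Qed.

Lemma lincomb0 : lincomb 0 = 0.
Proof. by apply: fsbig1 => s _; rewrite scale0r. Qed.

Lemma fsupportedD (u v : T -> T^o) : fsupported u -> fsupported v -> fsupported (u + v).
Proof. by move=> fu fv; have := fsupportedP 1 fu fv; rewrite scale1r. Qed.

Lemma fsupportedZ t (u : T -> T^o) : fsupported u -> fsupported (t *: u).
Proof.
by move=> fu; have := fsupportedP t fu fsupported0; rewrite addr0.
Qed.

Lemma fsupportedB (u v : T -> T^o) : fsupported u -> fsupported v -> fsupported (u - v).
Proof.
by move=> fu fv; have := fsupportedP (-1) fv fu; rewrite scaleN1r addrC.
Qed.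

Lemma lincombD u v : fsupported u -> fsupported v ->
  lincomb (u + v) = lincomb u + lincomb v.
Proof. by move=> fu fv; have := lincombP 1 fu fv; rewrite !scale1r. Qed.

Lemma lincombZ t u : fsupported u -> lincomb (t *: u) = t *: lincomb u.
Proof.
by move=> fu; have := lincombP t fu fsupported0; rewrite lincomb0 !addr0.
Qed.

Lemma lincombB u v : fsupported u -> fsupported v ->
  lincomb (u - v) = lincomb u - lincomb v.
Proof.
by move=> fu fv; have := lincombP (-1) fv fu; rewrite !scaleN1r ![- _ + _]addrC.
Qed.

End LinComb.

(** Only finitely supported combinations are meaningful for [lincomb], whereas
    [relations_span] quantifies over arbitrary submodules; intersecting with
    the submodule of finitely supported functions bridges the gap. *)
Lemma span_ind (T : comPzRingType) (rel : set (T -> T^o)) (P : (T -> T^o) -> Prop)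
    (a : T -> T^o) :
  relations_span rel a ->
  P 0 -> (forall t u v, fsupported u -> fsupported v -> P u -> P v -> P (t *: u + v)) ->
  (forall r, rel r -> fsupported r /\ P r) -> P a.
Proof.
move=> ra P0 Pl Pr; suff [] : fsupported a /\ P a by [].
apply: (ra [set u | fsupported u /\ P u]) => //=.
- by split=> //; exact: fsupported0.
- by move=> t u v [fu Pu] [fv Pv]; split; [exact: fsupportedP | exact: Pl].
Qed.

(** The universal property of a module given by generators and relations: the
    value on m is computed on any expression of m in the generators, and two
    expressions differ by an element of the span of the relations. *)
Lemma presented_lift (T : comPzRingType) (M G : lmodType T) (tau : T -> M)
    (rel : set (T -> T^o)) (E : T -> G) :
  presented rel tau ->
  (forall r, rel r -> fsupported r /\ lincomb E r = 0) ->
  exists2 phi : M -> G, (forall t m n, phi (t *: m + n) = t *: phi m + phi n) &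
    forall s, phi (tau s) = E s.
Proof.
move=> [gen ker] hrel.
have /choice[c hc] (m : M) : exists a, fsupported a /\ m = lincomb tau a.
  by have [a fa ->] := gen m; exists a.
have key m a : fsupported a -> m = lincomb tau a ->
    lincomb E (c m) = lincomb E a.
  have [fc ec] := hc m; move=> fa ea; apply/eqP; rewrite -subr_eq0; apply/eqP.
  rewrite -lincombB //.
  have /(ker _ (fsupportedB fc fa)) sp : lincomb tau (c m - a) = 0.
    by rewrite lincombB // -ec -ea subrr.
  apply: (span_ind sp (P := fun u => lincomb E u = 0)) => //.
  - exact: lincomb0.
  - by move=> t u v fu fv hu hv; rewrite lincombP // hu hv scaler0 addr0.
exists (fun m => lincomb E (c m)) => [t m n|s].
  have [[fm em] [fn en]] := (hc m, hc n).
  rewrite (@key _ (t *: c m + c n)); first by rewrite lincombP.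
    exact: fsupportedP.
  by rewrite lincombP // -em -en.
rewrite (@key _ (symb s)) ?lincomb_symb //; exact: fsupported_symb.
Qed.

Lemma presented_ind (T : comPzRingType) (M : lmodType T) (tau : T -> M)
    (rel : set (T -> T^o)) (P : M -> Prop) :
  presented rel tau -> P 0 ->
  (forall t m n, P m -> P n -> P (t *: m + n)) ->
  (forall s, P (tau s)) -> forall m, P m.
Proof.
move=> [gen _] P0 Pl Pt m; have [a fa ->] := gen m.
elim/big_ind: _ => //= [x y Px Py|s _].
  by have := Pl 1 x y Px Py; rewrite scale1r.
by rewrite -[_ *: _]addr0; exact: Pl.
Qed.

Section Relations.
Variables (K : closedFieldType) (T : comPzRingType) (c : K -> T).
Variables (delta : K -> K) (G : lmodType T) (E : T -> G).

Let evaluates (a : T -> T^o) (v : G) := fsupported a /\ lincomb E a = v.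

Let evaluates_symb r : evaluates (symb r) (E r).
Proof. by split; [exact: fsupported_symb | exact: lincomb_symb]. Qed.

Let evaluatesZ t a v : evaluates a v -> evaluates (t *: a) (t *: v).
Proof. by case=> fa <-; split; [exact: fsupportedZ | exact: lincombZ]. Qed.

Let evaluatesD a b v w : evaluates a v -> evaluates b w -> evaluates (a + b) (v + w).
Proof.
by move=> [fa <-] [fb <-]; split; [exact: fsupportedD | exact: lincombD].
Qed.

Let evaluatesB a b v w : evaluates a v -> evaluates b w -> evaluates (a - b) (v - w).
Proof.
by move=> [fa <-] [fb <-]; split; [exact: fsupportedB | exact: lincombB].
Qed.

Let eval_add r s :
  evaluates (symb (r + s) - (symb r + symb s)) (E (r + s) - (E r + E s)).
Proof. by apply: evaluatesB => //; exact: evaluatesD. Qed.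

Let eval_mul r s : evaluates (symb (r * s) - (r *: symb s + s *: symb r))
  (E (r * s) - (r *: E s + s *: E r)).
Proof. by apply: evaluatesB => //; apply: evaluatesD; exact: evaluatesZ. Qed.

Let eval_cst a b :
  evaluates (c (delta a) *: symb (c b) - c (delta b) *: symb (c a))
    (c (delta a) *: E (c b) - c (delta b) *: E (c a)).
Proof. by apply: evaluatesB; exact: evaluatesZ. Qed.

(** This lemma and [tau_rel_kill] supply the hypothesis of [presented_lift] for the
    two kinds of differentials. *)
Lemma kahler_rel_kill :
  (forall r s, E (r + s) = E r + E s) ->
  (forall r s, E (r * s) = r *: E s + s *: E r) ->
  (forall a, E (c a) = 0) ->
  forall r, kahler_rel c r -> fsupported r /\ lincomb E r = 0.
Proof.
move=> ED EM Ec _ [r s|r s|a].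
- by have := eval_add r s; rewrite ED subrr.
- by have := eval_mul r s; rewrite EM subrr.
- by have := evaluates_symb (c a); rewrite Ec.
Qed.

Lemma tau_rel_kill :
  (forall r s, E (r + s) = E r + E s) ->
  (forall r s, E (r * s) = r *: E s + s *: E r) ->
  (forall a b, c (delta a) *: E (c b) = c (delta b) *: E (c a)) ->
  forall r, tau_rel c delta r -> fsupported r /\ lincomb E r = 0.
Proof.
move=> ED EM Ec _ [r s|r s|a b].
- by have := eval_add r s; rewrite ED subrr.
- by have := eval_mul r s; rewrite EM subrr.
- by have := eval_cst a b; rewrite Ec subrr.
Qed.

Lemma presented_rel0 (rel : set (T -> T^o)) a v :
  presented rel E -> rel a -> evaluates a v -> v = 0.
Proof.
by move=> [_ ker] ra [fa <-]; apply/(ker a fa) => N _ _; exact.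
Qed.

Lemma presented_kahler : presented (kahler_rel c) E ->
  [/\ forall r s, E (r + s) = E r + E s,
      forall r s, E (r * s) = r *: E s + s *: E r &
      forall a, E (c a) = 0].
Proof.
move=> pE; split=> [r s|r s|a].
- by apply/eqP; rewrite -subr_eq0; apply/eqP;
    exact: (presented_rel0 pE (KahlerAdd c r s)).
- by apply/eqP; rewrite -subr_eq0; apply/eqP;
    exact: (presented_rel0 pE (KahlerMul c r s)).
- exact: (presented_rel0 pE (KahlerCst c a)).
Qed.

Lemma presented_tau : presented (tau_rel c delta) E ->
  [/\ forall r s, E (r + s) = E r + E s,
      forall r s, E (r * s) = r *: E s + s *: E r &
      forall a b, c (delta a) *: E (c b) = c (delta b) *: E (c a)].
Proof.
move=> pE; split=> [r s|r s|a b].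
- by apply/eqP; rewrite -subr_eq0; apply/eqP;
    exact: (presented_rel0 pE (TauAdd c delta r s)).
- by apply/eqP; rewrite -subr_eq0; apply/eqP;
    exact: (presented_rel0 pE (TauMul c delta r s)).
- by apply/eqP; rewrite -subr_eq0; apply/eqP;
    exact: (presented_rel0 pE (TauCst c delta a b)).
Qed.

End Relations.

(** * Gluing of sections; basic open subsets of affine opens *)

Section Sheaves.
Variables (K : closedFieldType) (X : kspace K) (F : omodule X).
Implicit Types U V W : opens X.

Lemma mres_loc_eq U (s t : F U) :
  (forall x, U x -> exists V (h : V `<=` U), V x /\ mres h s = mres h t) ->
  s = t.
Proof.
move=> loc; pose I := {V : opens X | exists h : V `<=` U, mres h s = mres h t}.
have hV (i : I) : sval i `<=` U by case: i => V /= [].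
have eqV (i : I) : mres (hV i) s = mres (hV i) t.
  by case: (svalP i) => h; rewrite (Prop_irrelevance h (hV i)).
have cover x : U x -> exists i : I, (sval i : opens X) x.
  by move=> /loc[V [h [Vx e]]]; exists (exist _ V (ex_intro _ h e)).
have [|w [_ uw]] := msheaf hV cover (s := fun i => mres (hV i) s).
  by move=> i j W hi hj; rewrite !(@mres_comp _ _ F _ _ _ _ _ (subset_trans hi (hV i))).
by rewrite -(uw s) //; apply: uw => i; rewrite eqV.
Qed.

(** Gluing for sections that are characterized by a local property P rather
    than given on a cover: P being functional makes the local choices agree on
    overlaps, for every open on which it has a solution. *)
Lemma mres_glue U (P : forall V, F V -> Prop) :
  (forall V W (h : W `<=` V) m, V `<=` U -> P V m -> P W (mres h m)) ->
  (forall V m n, V `<=` U -> P V m -> P V n -> m = n) ->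
  (forall x, U x -> exists V, [/\ V `<=` U, V x & exists m, P V m]) ->
  exists t : F U, forall V (h : V `<=` U) m, P V m -> mres h t = m.
Proof.
move=> Pres Puniq Ploc.
pose I := {V : opens X & {m : F V | V `<=` U /\ P V m}}.
pose V (i : I) : opens X := projT1 i.
pose s (i : I) : F (V i) := sval (projT2 i).
have hV (i : I) : V i `<=` U by case: (svalP (projT2 i)).
have hs (i : I) : P (V i) (s i) by case: (svalP (projT2 i)).
have cover x : U x -> exists i : I, V i x.
  by move=> /Ploc[W [h Wx [m Pm]]]; exists (existT _ W (exist _ m (conj h Pm))).
have [|t [ht _]] := msheaf hV cover (s := s).
  move=> i j W hi hj; apply: Puniq; first exact: subset_trans hi (hV i).
    exact: Pres (hV i) (hs i).
  exact: Pres (hV j) (hs j).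
exists t => W h m Pm.
pose i : I := existT _ W (exist _ m (conj h Pm)).
by have := ht i; rewrite (Prop_irrelevance (hV i) h).
Qed.

End Sheaves.

Section Affine.
Variables (K : closedFieldType) (X : kspace K).
Implicit Types U V W : opens X.

Lemma unit_at_res U V (h : V `<=` U) (f : reg U) x : V x ->
  unit_at (ores h f) x <-> unit_at f x.
Proof.
move=> Vx; split=> [[W [k [Wx inv]]]|[W [k [Wx [g fg]]]]].
  exists W, (subset_trans k h); split=> //.
  by rewrite -(ores_comp h k).
have hVW : opensI V W `<=` V by move=> y [].
have hWW : opensI V W `<=` W by move=> y [].
exists (opensI V W), hVW; split; first by split.
exists (ores hWW g).
rewrite (ores_comp h hVW (subset_trans hVW h)).
by rewrite -(ores_comp k hWW (subset_trans hVW h)) -rmorphM fg rmorph1.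
Qed.

Lemma unit_at_invertible U (f : reg U) x : U x -> invertible f -> unit_at f x.
Proof.
by move=> Ux inv; exists U, (@subset_refl _ U); split=> //; rewrite ores_id.
Qed.

Lemma invertible1 (T : comPzRingType) : invertible (1 : T).
Proof. by exists 1; rewrite mulr1. Qed.

Lemma unit_atM U (f g : reg U) x : U x ->
  unit_at (f * g) x <-> unit_at f x /\ unit_at g x.
Proof.
move=> Ux; split=> [[W [k [Wx [u]]]]|[[V [k [Vx [u fu]]]] [W [l [Wx [v gv]]]]]].
  rewrite rmorphM => fgu.
  split; exists W, k; split=> //; [exists (ores k g * u)|exists (ores k f * u)].
    by rewrite mulrA.
  by rewrite mulrCA mulrA.
have hV : opensI V W `<=` V by move=> y [].
have hW : opensI V W `<=` W by move=> y [].
exists (opensI V W), (subset_trans hV k); split; first by split.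
exists (ores hV u * ores hW v).
rewrite rmorphM mulrACA.
rewrite -{1}(ores_comp k hV) -rmorphM fu rmorph1 mul1r.
by rewrite -(ores_comp l hW) -rmorphM gv rmorph1.
Qed.

Lemma unit_atX U (f : reg U) n x : U x -> unit_at f x -> unit_at (f ^+ n) x.
Proof.
move=> Ux uf; elim: n => [|n IH].
  by rewrite expr0; apply: unit_at_invertible => //; exact: invertible1.
by rewrite exprS; apply/unit_atM.
Qed.

Lemma open_D U (f : reg U) : open [set y | U y /\ unit_at f y].
Proof.
rewrite openE => y [Uy [V [h [Vy inv]]]].
have VD : V `<=` [set y | U y /\ unit_at f y].
  by move=> z Vz; split; [exact: (h _ Vz) | exists V, h].
by apply: (filterS VD); apply: open_nbhs_nbhs; split=> //; exact: open_oset.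
Qed.

Definition basic_open U (f : reg U) : opens X := Opens (open_D f).

Lemma basic_open_sub U (f : reg U) : basic_open f `<=` U.
Proof. by move=> x []. Qed.

(** D(f) inside Spec T is Spec T_f.  Every g in T_f is a / f^n, and since f is a
    unit at all points of D(f), being a unit at y, lying in a prime, or
    vanishing after restriction are the same for g and for a; each clause is
    thus inherited from the corresponding one for T. *)
Lemma affine_basic_open U (f : reg U) : affine U -> affine (basic_open f).
Proof.
move=> [Up Upt Ubase Uloc]; set V := basic_open f.
have h : V `<=` U := @basic_open_sub U f.
have [|[u fu] frac ann] := Uloc f V h; first by move=> y.
have Vunit y : V y -> unit_at f y by case.
(* sections over D(f) are fractions a / f^n, whose denominators are units *)
have fracP (g : reg V) : exists n a, ores h a = g * ores h f ^+ n /\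
    forall y, V y -> (unit_at g y <-> unit_at a y).
  have [n [a e]] := frac g; exists n, a; split=> // y Vy.
  rewrite -(unit_at_res h a Vy) e; split=> [gy|/unit_atM[]//].
  apply/unit_atM => //; split=> //; apply: unit_atX => //.
  by apply/unit_at_res => //; exact: Vunit.
split.
- move=> x Vx; have Ux := h _ Vx; have [p0 pD pM p1 pP] := Up x Ux.
  split=> /=.
  + by rewrite -(rmorph0 (ores h)) unit_at_res.
  + move=> g1 g2.
    have [n1 [a1 [e1 /(_ x Vx) ->]]] := fracP g1.
    have [n2 [a2 [e2 /(_ x Vx) ->]]] := fracP g2.
    move=> na1 na2 ug; apply: (pD (a1 * f ^+ n2) (a2 * f ^+ n1)) => /=.
    * by rewrite unit_atM // => -[].
    * by rewrite unit_atM // => -[].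
    rewrite -(unit_at_res h _ Vx).
    have -> : ores h (a1 * f ^+ n2 + a2 * f ^+ n1) = (g1 + g2) * ores h f ^+ (n1 + n2).
      by rewrite rmorphD !rmorphM e1 e2 !rmorphXn exprD; ring.
    apply/unit_atM => //; split=> //; apply: unit_atX => //.
    by apply/unit_at_res => //; exact: Vunit.
  + by move=> a b nb /unit_atM; case.
  + by apply; apply: unit_at_invertible => //; exact: invertible1.
  + move=> a b nab; apply: contrapT => /not_orP[/contrapT ua /contrapT ub].
    by apply: nab; apply/unit_atM.
- move=> p [p0 pD pM p1 pP].
  have [|x [[Ux xP] xU]] := Upt [set a | p (ores h a)].
    split=> /=; rewrite ?rmorph0 ?rmorph1 //.
    + by move=> a b pa pb; rewrite rmorphD; exact: pD.
    + by move=> a b pb; rewrite rmorphM; exact: pM.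
    + by move=> a b; rewrite rmorphM; exact: pP.
  have pf n : ~ p (ores h f ^+ n).
    move=> pfn; apply: p1; have -> : 1 = u ^+ n * ores h f ^+ n.
      by rewrite -exprMn mulrC fu expr1n.
    exact: pM.
  have Vx : V x.
    split=> //; apply: contrapT => nf; apply: (pf 1%N); rewrite expr1.
    exact/xP.
  have pE g : p g <-> ~ unit_at g x.
    have [n [a [e /(_ x Vx) ->]]] := fracP g.
    rewrite -xP /= e; split=> [pg|]; first by rewrite mulrC; exact: pM.
    by move=> /pP[//|/pf].
  exists x; split=> // y [Vy yP].
  apply: xU; split; first by apply: (h).
  by move=> a /=; rewrite yP unit_at_res.
- move=> W x WV Wx.
  have [g [gx gW]] := Ubase W x (subset_trans WV h) Wx.
  exists (ores h g); split; first by apply/unit_at_res => //; exact: WV.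
  by move=> y Vy; rewrite unit_at_res // => gy; apply: gW => //; apply: (h).
- move=> g W hW Wg.
  have [n [a [e aP]]] := fracP g.
  have hWU := subset_trans hW h.
  (* D(g) in D(f) is D(a f) in U *)
  have [|[v av] frW anW] := Uloc (a * f) W hWU.
    move=> y; rewrite Wg; split=> [[Vy gy]|[Uy /unit_atM[//|ay fy]]].
      split; first by apply: (h).
      apply/unit_atM; [by apply: (h) | split; [exact/aP | exact: Vunit]].
    have Vy : V y by [].
    by split=> //; apply/aP.
  have ea : ores hWU a = ores hW g * ores hWU f ^+ n.
    by rewrite -(ores_comp h hW hWU) e rmorphM rmorphXn (ores_comp h hW hWU).
  have fuW : ores hWU f * ores hW u = 1.
    by rewrite -(ores_comp h hW hWU) -rmorphM fu rmorph1.
  split.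
  + exists (ores hWU f ^+ n.+1 * v); rewrite -av rmorphM ea exprS; ring.
  + move=> t; have [m [b eb]] := frW t.
    exists m, (ores h b * u ^+ (n.+1 * m)).
    rewrite rmorphM rmorphXn (ores_comp h hW hWU) eb rmorphM ea.
    transitivity (t * ores hW g ^+ m * (ores hWU f * ores hW u) ^+ (n.+1 * m)).
      by rewrite !exprM !exprS !exprMn; ring.
    by rewrite fuW expr1n mulr1.
  + move=> b b0; have [m [c [ec _]]] := fracP b.
    have [|k hk] := anW c.
      by rewrite -(ores_comp h hW hWU) ec rmorphM b0 mul0r.
    exists k; have := congr1 (ores h) hk.
    rewrite rmorph0 rmorphM rmorphXn rmorphM e ec => hh.
    transitivity ((g * ores h f ^+ n * ores h f) ^+ k * (b * ores h f ^+ m)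
        * u ^+ (n.+1 * k + m)).
      transitivity (g ^+ k * b * (ores h f * u) ^+ (n.+1 * k + m)).
        by rewrite fu expr1n mulr1.
      by rewrite !(exprD _ (n.+1 * k)%N m) !(exprM _ n.+1) !exprS !exprMn; ring.
    by rewrite hh mul0r.
Qed.

Lemma affine_base U x : is_scheme X -> U x ->
  exists V, [/\ affine V, V `<=` U & V x].
Proof.
move=> /(_ x)[W Wx aW] Ux; have [_ _ base _] := aW.
have [f [fx fU]] := base (opensI U W) x (fun y => @proj2 _ _) (conj Ux Wx).
exists (basic_open f); split; first exact: affine_basic_open.
  by move=> y [Wy fy]; have [] := fU y Wy fy.
by split.
Qed.

End Affine.

(** * Universal property of sheaves of differentials *)

Section UniversalProperty.
Variables (K : closedFieldType) (X : kspace K) (M : omodule X).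
Variable t : forall V : opens X, reg V -> M V.
Variable rel : forall V : opens X, set (reg V -> (reg V)^o).
Hypothesis schX : is_scheme X.
Hypothesis t_res : forall (U V : opens X) (h : V `<=` U) r,
  mres h (t r) = t (ores h r).
Hypothesis t_pres : forall V, affine V -> presented (@rel V) (@t V).
Variables (G : omodule X) (U : opens X).

Lemma mres_irr (F : omodule X) (V W : opens X) (h h' : W `<=` V) (m : F V) :
  mres h m = mres h' m.
Proof. by rewrite (Prop_irrelevance h h'). Qed.

(** M is generated by the symbols t r on every affine open, and these form a
    base, so a morphism out of M is determined by its values on symbols. *)
Lemma lochom_ext (f g : lochom M G U) :
  (forall (V : opens X) (h : V `<=` U) r, f V h (t r) = g V h (t r)) -> f = g.
Proof.
move=> fg; apply: lochomP => V h m; apply: mres_loc_eq => x Vx.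
have [W [aW hWV Wx]] := affine_base schX Vx.
exists W, hWV; split=> //.
rewrite !(lh_res _ h hWV (subset_trans hWV h)).
apply: (presented_ind (t_pres aW)
  (P := fun n => f W _ n = g W _ n)) => [|a n n' en en'|s].
- have /= lf := lh_linear f (subset_trans hWV h) (-1) 0 0.
  have /= lg := lh_linear g (subset_trans hWV h) (-1) 0 0.
  by move: lf lg; rewrite !scaleN1r !oppr0 !addr0 !addNr => -> ->.
- by rewrite !lh_linear en en'.
- exact: fg.
Qed.

Variable E : forall V : opens X, V `<=` U -> reg V -> G V.
Hypothesis E_res : forall (V W : opens X) (hV : V `<=` U) (hW : W `<=` V)
  (hWU : W `<=` U) r, mres hW (E hV r) = E hWU (ores hW r).
Hypothesis E_kill : forall (V : opens X) (h : V `<=` U), affine V ->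
  forall r, rel r -> fsupported r /\ lincomb (E h) r = 0.

(** The sheaf version of [presented_lift].  The universal property yields
    morphisms phi on affine opens only; they commute with restriction because
    they do so on symbols, and the value on an arbitrary open is glued from
    those on the affine opens inside it. *)
Lemma lochom_lift : exists f : lochom M G U,
  forall (V : opens X) (h : V `<=` U) r, f V h (t r) = E h r.
Proof.
pose phi (V : opens X) (h : V `<=` U) (a : affine V) : M V -> G V :=
  s2val (cid2 (presented_lift (t_pres a) (E_kill h a))).
have phi_lin V h a c m n : @phi V h a (c *: m + n) = c *: phi V h a m + phi V h a n.
  by rewrite /phi; case: cid2.
have phi_t V h a r : @phi V h a (t r) = E h r.
  by rewrite /phi; case: cid2.
have phi0 V h a : @phi V h a 0 = 0.
  have := phi_lin V h a (-1) 0 0.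
  by rewrite !scaleN1r !oppr0 !addr0 addNr.
have phi_res (V W : opens X) h a h' a' (k : W `<=` V) m :
    mres k (@phi V h a m) = @phi W h' a' (mres k m).
  apply: (presented_ind (t_pres a)
    (P := fun n => mres k (@phi V h a n) = @phi W h' a' (mres k n))) => [|c n n' en en'|s].
  - by rewrite phi0 !raddf0 phi0.
  - by rewrite phi_lin !raddfD /= !mres_scale en en' phi_lin.
  - by rewrite phi_t t_res phi_t (E_res h k h').
pose Q (V : opens X) (m : M V) (W : opens X) (g : G W) :=
  forall (W' : opens X) (k : W' `<=` W) (l : W' `<=` V)
  (h : W' `<=` U) (a : affine W'), mres k g = phi W' h a (mres l m).
have Q_uniq (V : opens X) m (W : opens X) g g' :
    W `<=` V -> W `<=` U -> Q V m W g -> Q V m W g' -> g = g'.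
  move=> l hW q q'; apply: mres_loc_eq => x Wx.
  have [W' [a k W'x]] := affine_base schX Wx.
  exists W', k; split=> //.
  by rewrite (q _ k (subset_trans k l) (subset_trans k hW) a)
     (q' _ k (subset_trans k l) (subset_trans k hW) a).
have ex (V : opens X) (h : V `<=` U) m : exists g : G V, Q V m V g.
  have [||x Vx|g hg] := @mres_glue K X G V (Q V m).
  - move=> W W' k g hW q W'' k' l h'' a.
    by rewrite (@mres_comp _ _ G _ _ _ _ _ (subset_trans k' k)); exact: q.
  - by move=> W g g' l; apply: Q_uniq => //; exact: subset_trans l h.
  - have [W [a l Wx]] := affine_base schX Vx.
    have hW := subset_trans l h.
    exists W; split=> //; exists (phi W hW a (mres l m)) => W' k l' h' a'.
    by rewrite (phi_res _ _ _ _ h' a') (@mres_comp _ _ M _ _ _ _ _ l').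
  exists g => W k l hW a.
  rewrite (mres_irr k l); apply: hg => W' k' l' h' a'.
  by rewrite (phi_res _ _ _ _ h' a') (@mres_comp _ _ M _ _ _ _ _ l').
pose f (V : opens X) (h : V `<=` U) m := sval (cid (ex V h m)).
have fP V h m : Q V m V (@f V h m) by rewrite /f; case: cid.
have f_lin V h (a : reg V) m n : @f V h (a *: m + n) = a *: f V h m + f V h n.
  apply: (Q_uniq V (a *: m + n)); [by []|exact: (h)|exact: fP|] => W k l hW aW.
  rewrite raddfD /= mres_scale (fP V h m W k l hW aW) (fP V h n W k l hW aW).
  by rewrite (raddfD (mres l)) mres_scale phi_lin (Prop_irrelevance k l).
have f_res (V W : opens X) h (k : W `<=` V) h' m : mres k (@f V h m) = @f W h' (mres k m).
  apply: (Q_uniq W (mres k m)); [by []|exact: (h')| |exact: fP] => W' l l' hW' aW'.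
  rewrite (@mres_comp _ _ G _ _ _ _ _ (subset_trans l k)).
  rewrite (@mres_comp _ _ M _ _ _ _ _ (subset_trans l' k)).
  exact: fP.
exists (@LocHom _ _ M G U f f_lin (fun V W h k h' m => f_res V W h k h' m)).
move=> V h r /=.
apply: (Q_uniq V (t r)); [by []|exact: (h)|exact: fP|] => W k l hW aW.
by rewrite (E_res h k hW) t_res phi_t (Prop_irrelevance k l).
Qed.

End UniversalProperty.

(** * Derivations on integral schemes *)

Section DerivationBasics.
Variables (R : comPzRingType) (D : R -> R).
Hypothesis derD : derivation D.

Lemma derivationB r s : D (r - s) = D r - D s.
Proof.
by apply: (@addIr _ (D s)); rewrite -derD.1 !subrK.
Qed.

Lemma derivation1 : D 1 = 0.
Proof.
have := derD.2 1 1; rewrite mulr1 mul1r => e.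
by apply: (@addrI _ (D 1)); rewrite addr0.
Qed.

End DerivationBasics.

Section Integral.
Variables (K : closedFieldType) (X : kspace K).
Hypothesis schX : is_scheme X.
Hypothesis intX : integral_scheme X.
Implicit Types U V W : opens X.

Lemma ores_loc_eq U (s t : reg U) :
  (forall x, U x -> exists V (h : V `<=` U), V x /\ ores h s = ores h t) ->
  s = t.
Proof. exact: (@mres_loc_eq K X (omod1 X)). Qed.

Lemma reg_one_neq0 U x : U x -> (1 : reg U) <> 0.
Proof. by move=> Ux; have [] := (proj2 intX) U (ex_intro _ x Ux). Qed.

Lemma reg_domain U x (a b : reg U) : U x -> a * b = 0 -> a = 0 \/ b = 0.
Proof.
by move=> Ux; have [_] := (proj2 intX) U (ex_intro _ x Ux); apply.
Qed.

Lemma reg_mulI U x (c a b : reg U) : U x -> c <> 0 -> c * a = c * b -> a = b.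
Proof.
move=> Ux c0 e; have : c * (a - b) = 0 by rewrite mulrBr e subrr.
by case/(reg_domain Ux) => // /eqP; rewrite subr_eq0 => /eqP.
Qed.

(** An integral scheme is irreducible: the sections over a disjoint union form
    the product of the two rings of sections, which is not a domain. *)
Lemma opens_meet U V u v : U u -> V v -> exists w, U w /\ V w.
Proof.
move=> Uu Vv; apply: contrapT => disj.
have dis w : U w -> V w -> False by move=> *; apply: disj; exists w.
pose W : opens X := Opens (openU (open_oset U) (open_oset V)).
have hU : U `<=` W by move=> x; left.
have hV : V `<=` W by move=> x; right.
have idem (A B : opens X) : (forall w, A w -> B w -> False) ->
    (forall x, W x -> A x \/ B x) -> forall (hA : A `<=` W) (hB : B `<=` W),
    exists e : reg W, ores hA e = 1 /\ ores hB e = 0.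
  move=> dAB cov hA hB.
  pose P (Y : opens X) (m : omod1 X Y) :=
    (Y `<=` A /\ m = 1 :> reg Y) \/ (Y `<=` B /\ m = 0 :> reg Y).
  have [||x Wx|e he] := @mres_glue K X (omod1 X) W P.
  - move=> Y Z h m _ [[l ->]|[l ->]]; [left|right].
      by split; [exact: subset_trans h l | exact: rmorph1].
    by split; [exact: subset_trans h l | exact: rmorph0].
  - move=> Y m n _ [[l ->]|[l ->]] [[l' ->]|[l' ->]] //.
      apply: (@mres_loc_eq K X (omod1 X)) => x Yx.
      by case: (dAB x (l x Yx) (l' x Yx)).
    apply: (@mres_loc_eq K X (omod1 X)) => x Yx.
    by case: (dAB x (l' x Yx) (l x Yx)).
  - case: (cov x Wx) => [Ax|Bx]; [exists A|exists B]; split=> //.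
      by exists (1 : reg A); left; split.
    by exists (0 : reg B); right; split.
  by exists e; split; apply: he; [left; split|right; split].
(* orthogonal idempotents on the disjoint union contradict integrality *)
have [e [eU eV]] := idem U V dis (fun x h => h) hU hV.
have [] := idem V U _ _ hV hU.
- by move=> w Vw Uw; exact: dis Uw Vw.
- by move=> x [] ?; [right|left].
move=> e' [eV' eU'].
have /(@reg_domain W u) : e * e' = 0.
  apply: ores_loc_eq => x [Ux|Vx]; [exists U, hU|exists V, hV]; split=> //.
    by rewrite rmorphM eU' mulr0 rmorph0.
  by rewrite rmorphM eV mul0r rmorph0.
case=> [|e0|e0]; first exact: hU u Uu.
  by apply: (reg_one_neq0 Uu); rewrite -eU e0 rmorph0.
by apply: (reg_one_neq0 Vv); rewrite -eV' e0 rmorph0.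
Qed.

Lemma unit_at_expn_neq0 U (f : reg U) x n : U x -> unit_at f x -> f ^+ n <> 0.
Proof.
move=> Ux /(unit_atX n Ux)[W [h [Wx [u fu]]]] f0.
by apply: (reg_one_neq0 Wx); rewrite -fu f0 rmorph0 mul0r.
Qed.

(** If f vanishes on V, then by irreducibility every affine A meets V in a point
    with a neighbourhood D(g) on which f vanishes; some g^n kills f over A, and
    g^n is nonzero in the domain O(A). *)
Lemma ores_inj0 U V (h : V `<=` U) x (f : reg U) : V x -> ores h f = 0 -> f = 0.
Proof.
move=> Vx f0; apply: ores_loc_eq => y Uy.
have [A [aA hA Ay]] := affine_base schX Uy.
exists A, hA; split=> //; rewrite rmorph0.
have [w [Aw Vw]] := opens_meet Ay Vx.
have [_ _ base loc] := aA.
have [g [gw gV]] := base (opensI A V) w (fun y => @proj1 _ _) (conj Aw Vw).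
have DA := @basic_open_sub _ _ _ g.
have [|_ _ ann] := loc g (basic_open g) DA; first by move=> z.
have DV : basic_open g `<=` V by move=> z [Az gz]; have [] := gV z Az gz.
have [|n /(reg_domain Aw)[]//] := ann (ores hA f).
  rewrite (ores_comp hA DA (subset_trans DV h)).
  by rewrite -(ores_comp h DV) f0 rmorph0.
by move=> /(unit_at_expn_neq0 Aw gw).
Qed.

Lemma ores_inj U V (h : V `<=` U) x (f g : reg U) :
  V x -> ores h f = ores h g -> f = g.
Proof.
move=> Vx e; apply/eqP; rewrite -subr_eq0; apply/eqP.
by apply: (ores_inj0 (h := h) Vx); rewrite rmorphB e subrr.
Qed.

Lemma ores_neq0 U V (h : V `<=` U) x (f : reg U) :
  V x -> f <> 0 -> ores h f <> 0.
Proof. by move=> Vx f0 /(ores_inj0 Vx). Qed.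

Lemma reg_empty_eq U (a b : reg U) : ~ (exists x, U x) -> a = b.
Proof. by move=> n; apply: ores_loc_eq => x Ux; case: n; exists x. Qed.

Section Spread.
Variables (U : opens X) (D : reg U -> reg U).
Hypothesis affU : affine U.
Hypothesis derD : derivation D.

Let DD r s : D (r + s) = D r + D s. Proof. exact: derD.1. Qed.
Let DM r s : D (r * s) = r * D s + s * D r. Proof. exact: derD.2. Qed.
Let D1 : D 1 = 0.
Proof. exact: derivation1. Qed.

(** O(V) lies in the fraction field of O(U), to which D extends uniquely;
    [quotient_rule r t] says that t is the value at r of this extension,
    without constructing the field.  Over the empty open set there is nothing to
    say, the ring of sections being zero. *)
Definition quotient_rule V (h : V `<=` U) (r t : reg V) : Prop :=
  (exists x, V x) -> exists a b : reg U,
    [/\ b <> 0, ores h b * r = ores h a &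
        ores h b ^+ 2 * t = ores h (b * D a - a * D b)].

Lemma quotient_rule_uniq V (h : V `<=` U) r t t' :
  quotient_rule h r t -> quotient_rule h r t' -> t = t'.
Proof.
move=> q q'; case: (pselect (exists x, V x)) => [ne|]; last exact: reg_empty_eq.
have [a [b [b0 br bt]]] := q ne; have [a' [b' [b0' br' bt']]] := q' ne.
have [x Vx] := ne.
have e : b * a' = b' * a.
  by apply: (ores_inj (h := h) Vx); rewrite !rmorphM -br -br'; ring.
have De : b * D a' + a' * D b = b' * D a + a * D b' by rewrite -!DM e.
have nz : (ores h b * ores h b') ^+ 2 <> 0.
  have nb := ores_neq0 (h := h) Vx b0; have nb' := ores_neq0 (h := h) Vx b0'.
  by case/(reg_domain Vx) => /(reg_domain Vx)[].
apply: (reg_mulI Vx nz).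
transitivity (ores h b' ^+ 2 * (ores h b ^+ 2 * t)); first by ring.
transitivity (ores h b ^+ 2 * (ores h b' ^+ 2 * t')); last by ring.
rewrite bt bt' -!rmorphXn -!rmorphM; congr (ores h _).
apply/eqP; rewrite -subr_eq0; apply/eqP.
transitivity ((b * b') * ((b' * D a + a * D b') - (b * D a' + a' * D b))
   + (b' * D b + b * D b') * (b * a' - b' * a)); first by ring.
by rewrite De e !subrr !mulr0 addr0.
Qed.

Lemma quotient_rule_res V W (h : V `<=` U) (k : W `<=` V) (hW : W `<=` U) r t :
  quotient_rule h r t -> quotient_rule hW (ores k r) (ores k t).
Proof.
move=> q [x Wx]; have [|a [b [b0 br bt]]] := q; first by exists x; exact: k.
exists a, b; split=> //.
  by rewrite -!(ores_comp h k hW) -rmorphM br.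
by rewrite -!(ores_comp h k hW) -rmorphXn -rmorphM bt.
Qed.

(** Restriction being injective, a fraction representing r on a nonempty
    smaller open set represents it everywhere. *)
Lemma quotient_rule_dense V W (h : V `<=` U) (k : W `<=` V) (hW : W `<=` U) r t :
  (exists x, W x) ->
  quotient_rule hW (ores k r) (ores k t) -> quotient_rule h r t.
Proof.
move=> [x Wx] q _; have [|a [b [b0 br bt]]] := q; first by exists x.
exists a, b; split=> //; apply: (ores_inj (h := k) Wx).
  by rewrite rmorphM !(ores_comp h k hW).
by rewrite rmorphM rmorphXn !(ores_comp h k hW).
Qed.

Lemma quotient_rule_D V (h : V `<=` U) r t r' t' :
  quotient_rule h r t -> quotient_rule h r' t' ->
  quotient_rule h (r + r') (t + t').
Proof.
move=> q q' ne; have [x Vx] := ne; have Ux := h x Vx.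
have [a [b [b0 br bt]]] := q ne; have [a' [b' [b0' br' bt']]] := q' ne.
exists (a * b' + a' * b), (b * b'); split.
- by case/(reg_domain Ux).
- by rewrite rmorphD !rmorphM -br -br'; ring.
- transitivity (ores h b' ^+ 2 * (ores h b ^+ 2 * t) +
                ores h b ^+ 2 * (ores h b' ^+ 2 * t')).
    by rewrite rmorphM; ring.
  rewrite bt bt' -!rmorphXn -!rmorphM -rmorphD DD !DM; congr (ores h _); ring.
Qed.

Lemma quotient_rule_M V (h : V `<=` U) r t r' t' :
  quotient_rule h r t -> quotient_rule h r' t' ->
  quotient_rule h (r * r') (r * t' + r' * t).
Proof.
move=> q q' ne; have [x Vx] := ne; have Ux := h x Vx.
have [a [b [b0 br bt]]] := q ne; have [a' [b' [b0' br' bt']]] := q' ne.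
exists (a * a'), (b * b'); split.
- by case/(reg_domain Ux).
- by rewrite !rmorphM -br -br'; ring.
- transitivity (ores h b * (ores h b * r) * (ores h b' ^+ 2 * t') +
                ores h b' * (ores h b' * r') * (ores h b ^+ 2 * t)).
    by rewrite rmorphM; ring.
  rewrite bt bt' br br' -!rmorphM -rmorphD !DM; congr (ores h _); ring.
Qed.

Lemma quotient_rule_ores V (h : V `<=` U) r :
  quotient_rule h (ores h r) (ores h (D r)).
Proof.
move=> [x Vx]; exists r, 1; split; first exact: reg_one_neq0 (h x Vx).
  by rewrite rmorph1 mul1r.
by rewrite D1 mulr0 subr0 mul1r rmorph1 expr1n mul1r.
Qed.

(** Locally r is a fraction a / f^n with f invertible, where the quotient rule
    gives the value; by uniqueness these values glue. *)
Lemma quotient_rule_ex V (h : V `<=` U) r : exists t, quotient_rule h r t.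
Proof.
have [_ _ base loc] := affU.
pose P (Y : opens X) (m : omod1 X Y) :=
  forall (k : Y `<=` V), quotient_rule (subset_trans k h) (ores k r) m.
have Ploc x : V x -> exists Y : opens X, [/\ Y `<=` V, Y x & exists m, P Y m].
  move=> Vx; have [f [fx fV]] := base V x h Vx.
  have DU := @basic_open_sub _ _ _ f.
  have DV : basic_open f `<=` V by move=> z [Uz fz]; exact: fV.
  have [|[v fv] frac _] := loc f (basic_open f) DU; first by move=> z.
  have [n [a e]] := frac (ores DV r).
  have Ux := h x Vx.
  exists (basic_open f); split=> //.
  (* r = a / f^n on D(f), and v is the inverse of f there *)
  exists ((v ^+ n) ^+ 2 * ores DU (f ^+ n * D a - a * D (f ^+ n))) => k _.
  rewrite (Prop_irrelevance k DV) (Prop_irrelevance (subset_trans DV h) DU).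
  exists a, (f ^+ n); split; first exact: unit_at_expn_neq0 Ux fx.
    by rewrite e rmorphXn mulrC.
  by rewrite mulrA -exprMn rmorphXn -exprMn fv !expr1n mul1r.
have [||t ht] := @mres_glue K X (omod1 X) V P _ _ Ploc.
- move=> Y Z k m l Pm kZ.
  have := quotient_rule_res k (subset_trans kZ h) (Pm l).
  by rewrite (ores_comp l k kZ).
- move=> Y m n l Pm Pn; exact: quotient_rule_uniq (Pm l) (Pn l).
exists t => ne; have [x Vx] := ne.
have [Y [k Yx [m Pm]]] := Ploc x Vx.
apply: (@quotient_rule_dense V Y h k (subset_trans k h) r t) (ne).
  by exists x.
by have -> : ores k t = m by exact: ht Pm.
Qed.

(** A derivation of O(U) is the same thing as a derivation of the sheaf O on U:
    over V the quotient rule defines one, and forces any other that is compatible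
    with D to agree with it. *)
Lemma derivation_spread : exists E : forall V, V `<=` U -> reg V -> reg V,
  [/\ forall V (h : V `<=` U), derivation (E V h),
      forall V W (h : V `<=` U) (k : W `<=` V) (hW : W `<=` U) r,
        ores k (E V h r) = E W hW (ores k r),
      forall V (h : V `<=` U) r, E V h (ores h r) = ores h (D r) &
      forall V (h : V `<=` U) (D' : reg V -> reg V), derivation D' ->
        (forall r, D' (ores h r) = ores h (D r)) -> forall r, D' r = E V h r].
Proof.
pose E (V : opens X) (h : V `<=` U) r := sval (cid (quotient_rule_ex h r)).
have EP V (h : V `<=` U) r : quotient_rule h r (E V h r) by rewrite /E; case: cid.
have Eq V (h : V `<=` U) r t : quotient_rule h r t -> E V h r = t.
  exact: quotient_rule_uniq (EP V h r).
exists E; split.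
- by move=> V h; split=> r s; apply: Eq;
    [exact: quotient_rule_D | exact: quotient_rule_M].
- by move=> V W h k hW r; apply/esym/Eq; exact: quotient_rule_res (EP V h r).
- by move=> V h r; apply: Eq; exact: quotient_rule_ores.
- move=> V h D' [_ DM'] De r; apply/esym/Eq => ne.
  have [a [b [b0 br _]]] := EP V h r ne.
  exists a, b; split=> //.
  have := DM' (ores h b) r; rewrite br !De => e.
  by rewrite rmorphB !rmorphM -br e; ring.
Qed.

End Spread.
End Integral.

(** * Derivations of standard smooth algebras *)

Section PolynomialDerivation.
Variables (K : closedFieldType) (delta : K -> K).
Hypothesis derdelta : derivation delta.
Variables (T : comNzRingType) (c : {rmorphism K -> T}).
Variables (n : nat) (x y : 'I_n -> T).

Lemma coef_delta_additive : zmod_morphism (c \o delta).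
Proof. by move=> a b /=; rewrite derivationB // rmorphB. Qed.

Definition coef_delta : K -> T := c \o delta.

HB.instance Definition _ :=
  GRing.isZmodMorphism.Build _ _ coef_delta coef_delta_additive.

Lemma coef_deltaM a b :
  coef_delta (a * b) = c a * coef_delta b + c b * coef_delta a.
Proof. by rewrite /coef_delta /= derdelta.2 rmorphD !rmorphM. Qed.

Let ev : {rmorphism mpoly n K -> T} := mmap c x.

(** The derivation K[x_1, ..., x_n] -> T over the evaluation at x that extends
    delta and sends the variable x_j to y_j. *)
Definition poly_derivation (p : mpoly n K) : T :=
  mmap coef_delta x p + \sum_j y j * ev (mderiv j p).

Let mmapZX (f : {additive K -> T}) a m :
  mmap f x (a *: mpolyX K m) = f a * mmap1 x m.
Proof.
have [->|a0] := eqVneq a 0; first by rewrite scale0r !raddf0 mul0r.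
by rewrite /mmap msuppMCX // big_seq1 linearZ /= mcoeffX eqxx mulr1.
Qed.

Let mmap1D m m' : mmap1 x (mnm_add m m') = mmap1 x m * mmap1 x m'.
Proof. by rewrite -!(mmapX x c) mpolyXD rmorphM. Qed.

(* both sides are biadditive, so monomials suffice *)
Let coefM p q : mmap coef_delta x (p * q) =
  ev p * mmap coef_delta x q + ev q * mmap coef_delta x p.
Proof.
elim/mpolyind: p => [|a m p _ _ IHp]; first by rewrite mul0r !raddf0 mul0r mulr0 addr0.
suff IHX : mmap coef_delta x (a *: mpolyX K m * q) =
  ev (a *: mpolyX K m) * mmap coef_delta x q +
  ev q * mmap coef_delta x (a *: mpolyX K m).
  rewrite mulrDl [LHS]raddfD [mmap _ _ (_ + _)]raddfD rmorphD /= IHX IHp; ring.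
elim/mpolyind: q {IHp} => [|b m' q _ _ IHq].
  by rewrite mulr0 !raddf0 mul0r mulr0 addr0.
rewrite mulrDr [LHS]raddfD [mmap _ _ (_ *: _ + _)]raddfD rmorphD /= IHq.
rewrite -scalerAl -scalerAr scalerA -mpolyXD.
rewrite /ev /= !mmapZX mmap1D /= coef_deltaM; ring.
Qed.

Lemma poly_derivationD p q :
  poly_derivation (p + q) = poly_derivation p + poly_derivation q.
Proof.
rewrite /poly_derivation raddfD addrACA -big_split /=; congr (_ + _).
by apply: eq_bigr => j _; rewrite mderivD rmorphD mulrDr.
Qed.

Lemma poly_derivationM p q :
  poly_derivation (p * q) = ev p * poly_derivation q + ev q * poly_derivation p.
Proof.
rewrite /poly_derivation coefM !mulrDr addrACA !mulr_sumr -big_split /=.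
congr (_ + _); apply: eq_bigr => j _; rewrite mderivM rmorphD !rmorphM; ring.
Qed.

Lemma poly_derivationC a : poly_derivation (mpolyC n a) = c (delta a).
Proof.
rewrite /poly_derivation mmapC big1 ?addr0 // => j _.
by rewrite mderivC rmorph0 mulr0.
Qed.

End PolynomialDerivation.

(** With T = K[x]/(f_1, ..., f_k), a polynomial derivation descends to T as soon
    as it kills each f_i, that is, when
    sum_j y_j (df_i/dx_j)(x) = - f_i^delta(x).  The Jacobian in the first k
    variables is invertible, so one may take y_j = 0 for j > k and solve for the
    remaining y_j by Cramer's rule. *)
Lemma smooth_derivation_nz (K : closedFieldType) (delta : K -> K)
    (T : comNzRingType) (c : {rmorphism K -> T}) :
  derivation delta -> standard_smooth c ->
  exists2 D : T -> T, derivation D & forall a, D (c a) = c (delta a).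
Proof.
move=> derdelta [k [d [f [x [gen ker [u du]]]]]].
pose ev : {rmorphism mpoly (k + d)%N K -> T} := mmap c x.
have {}gen t : exists p, t = ev p := gen t.
pose J := \matrix_(i < k, j < k) ev (mderiv (lshift d j) (f i)).
have {}du : \det J * u = 1 by exact: du.
pose w := \col_i mmap (coef_delta delta c) x (f i).
pose v := u *: (\adj J *m w).
pose y (j : 'I_(k + d)) : T :=
  match fintype.split j with inl j' => - v j' ord0 | inr _ => 0 end.
have ev_f i : ev (f i) = 0.
  apply/ker; exists (fun j => (j == i)%:R).
  rewrite (bigD1 i) //= eqxx mul1r big1 ?addr0 // => j /negPf ->.
  by rewrite mul0r.
pose L := poly_derivation delta c x y.
have Lf i : L (f i) = 0.
  rewrite /L /poly_derivation big_split_ord /= [X in _ + (_ + X)]big1 ?addr0.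
    have -> : mmap (coef_delta delta c) x (f i) = (J *m v) i ord0.
      by rewrite -scalemxAr mulmxA mul_mx_adj mul_scalar_mx scalerA mulrC du scale1r mxE.
    rewrite mxE -big_split big1 //= => j _.
    rewrite /y; case: fintype.split_ordP => j' => [/lshift_inj <-|/eqP];
      last by rewrite eq_lrshift.
    by rewrite !mxE mulNr mulrC addrN.
  move=> j _; rewrite /y; case: fintype.split_ordP => j' => [/eqP|_]; last by rewrite mul0r.
  by rewrite eq_rlshift.
have LD p q : L (p + q) = L p + L q by exact: poly_derivationD.
have LM p q : L (p * q) = ev p * L q + ev q * L p by exact: poly_derivationM.
have L0 : L 0 = 0 by apply: (@addrI _ (L 0)); rewrite -LD !addr0.
have Lwd p q : ev p = ev q -> L p = L q.
  move=> e; have /ker[g eg] : ev (p - q) = 0 by rewrite rmorphB e subrr.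
  rewrite -[p](subrK q) LD eg -[RHS]add0r; congr (_ + _).
  elim/big_ind: _ => [//|a b ha hb|i _]; first by rewrite LD ha hb addr0.
  by rewrite LM Lf ev_f mulr0 mul0r addr0.
have /choice[lift liftP] := gen.
exists (fun t => L (lift t)).
  split=> r s; rewrite -?LD.
    by apply: Lwd; rewrite rmorphD -!liftP.
  rewrite {2}(liftP r) {3}(liftP s) -LM; apply: Lwd.
  by rewrite rmorphM -!liftP.
move=> a; rewrite -(poly_derivationC derdelta c x y a); apply: Lwd.
by rewrite -liftP /ev /= mmapC.
Qed.

(** A standard smooth algebra may be zero, and evaluation of polynomials by [mmap]
    takes values in nontrivial rings.  Sections over a nonempty open subset of an
    integral scheme form such a ring. *)
Lemma smooth_derivation (K : closedFieldType) (delta : K -> K)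
    (T : comPzRingType) (c : {rmorphism K -> T}) :
  (1 : T) <> 0 -> derivation delta -> standard_smooth c ->
  exists2 D : T -> T, derivation D & forall a, D (c a) = c (delta a).
Proof.
move=> /eqP nz.
pose T' : comNzRingType := HB.pack T (GRing.PzSemiRing_isNonZero.Build T nz).
exact: (@smooth_derivation_nz K delta T' c).
Qed.

(** * Cech cohomology classes *)

Section CechClasses.
Variables (X : topologicalType) (F : abpresheaf X).
Implicit Types (z : cocycle F) (U V W : opens X).

Lemma opensIl U V : opensI U V `<=` U. Proof. by move=> x []. Qed.
Lemma opensIr U V : opensI U V `<=` V. Proof. by move=> x []. Qed.

Definition coverI (A B : open_cover X) : open_cover X.
Proof.
apply: (@Cover X (cidx A * cidx B) (fun k => opensI (A k.1) (B k.2))) => x.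
by have [[i Ai] [j Bj]] := (cset_cover A x, cset_cover B x); exists (i, j).
Defined.

Lemma cohomologous_sym z z' : cohomologous z z' -> cohomologous z' z.
Proof.
move=> [W [r [r' [h [hr hr' e]]]]]; exists W, r', r, (fun k => - h k); split=> //.
move=> k l k1 k2 ek el; apply: oppr_inj.
by rewrite opprB (e k l k2 k1 ek el) !raddfN opprK opprD opprK addrC.
Qed.

(** On a common refinement the two refinement maps r1 and s into the middle cover
    need not agree; the cocycle relation shows that pulling z' back along them
    changes it by the coboundary of the cochain z'(r1 k, s k), the third summand
    of the cochain below. *)
Lemma cohomologous_trans z z' z'' :
  cohomologous z z' -> cohomologous z' z'' -> cohomologous z z''.
Proof.
move=> [A [r [r1 [h [hr hr1 eh]]]]] [B [s [s1 [g [hs hs1 eg]]]]].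
have hC (k : cidx (coverI A B)) : coverI A B k `<=` opensI (z' (r1 k.1)) (z' (s k.2)).
  by move=> x [Ax Bx]; split; [exact: hr1 | exact: hs].
exists (coverI A B), (fun k => r k.1), (fun k => s1 k.2), (fun k =>
  ares (@opensIl (A k.1) (B k.2)) (h k.1) + ares (@opensIr (A k.1) (B k.2)) (g k.2)
  + ares (hC k) (coch (r1 k.1) (s k.2))).
split=> [k|k|k l e e' ek el].
- by move=> x [/hr].
- by move=> x [_ /hs1].
set O := opensI _ _ in e e' ek el *.
have kA : O `<=` opensI (A k.1) (A l.1) by move=> x [[? _] [? _]].
have kB : O `<=` opensI (B k.2) (B l.2) by move=> x [[_ ?] [_ ?]].
have A1 : opensI (A k.1) (A l.1) `<=` opensI (z (r k.1)) (z (r l.1)).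
  by move=> x [/hr ? /hr ?].
have A2 : opensI (A k.1) (A l.1) `<=` opensI (z' (r1 k.1)) (z' (r1 l.1)).
  by move=> x [/hr1 ? /hr1 ?].
have B1 : opensI (B k.2) (B l.2) `<=` opensI (z' (s k.2)) (z' (s l.2)).
  by move=> x [/hs ? /hs ?].
have B2 : opensI (B k.2) (B l.2) `<=` opensI (z'' (s1 k.2)) (z'' (s1 l.2)).
  by move=> x [/hs1 ? /hs1 ?].
have := congr1 (ares kA) (eh k.1 l.1 A1 A2 (@opensIl _ _) (@opensIr _ _)).
have := congr1 (ares kB) (eg k.2 l.2 B1 B2 (@opensIl _ _) (@opensIr _ _)).
have C1 : O `<=` opensI (z' (r1 k.1)) (z' (s l.2)).
  by move=> x [[/hr1 ? _] [_ /hs ?]].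
have c1 := coch_cocycle (subset_trans kA A2) (subset_trans el (hC l)) C1.
have c2 := coch_cocycle (subset_trans ek (hC k)) (subset_trans kB B1) C1.
rewrite !raddfB !raddfD /=.
rewrite (ares_comp B2 kB e') (ares_comp B1 kB (subset_trans kB B1)).
rewrite (ares_comp A2 kA (subset_trans kA A2)) (ares_comp A1 kA e).
have kl1 : O `<=` A l.1 by move=> x [_ []].
have kl2 : O `<=` B l.2 by move=> x [_ []].
have kk1 : O `<=` A k.1 by move=> x [[]].
have kk2 : O `<=` B k.2 by move=> x [[]].
rewrite !(ares_comp _ _ kl1) !(ares_comp _ _ kl2) !(ares_comp _ _ kk1).
rewrite !(ares_comp _ _ kk2).
rewrite (ares_comp _ _ (subset_trans el (hC l))).
rewrite (ares_comp _ _ (subset_trans ek (hC k))).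
move: c1 c2; set x1 := ares _ (coch (r1 k.1) (r1 l.1)).
set x2 := ares _ (coch (r1 l.1) _); set x3 := ares C1 _.
set x4 := ares _ (coch (r1 k.1) (s k.2)); set x5 := ares _ (coch (s k.2) _).
move=> c1 c2 e2 e1.
have c12 : x5 - x1 = x2 - x4.
  by apply/eqP; rewrite subr_eq addrAC eq_sym subr_eq [x2 + _]addrC c1 -c2 addrC.
set z2 := ares e' _; set z0 := ares e _.
have -> : z2 - z0 = (x1 - z0) + (z2 - x5) + (x5 - x1).
  by rewrite -addrA subrKA addrC subrKA.
by rewrite e1 e2 c12 [RHS]addrACA; congr (_ + _); rewrite [RHS]addrACA.
Qed.

Lemma H1_class_eq z z' : cohomologous z z' -> H1_class z = H1_class z'.
Proof.
move=> c; apply: eq_sig_hprop; first by move=> *; exact: Prop_irrelevance.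
rewrite /=; apply/funext => w; apply/propext; split=> cw.
  exact: cohomologous_trans (cohomologous_sym c) cw.
exact: cohomologous_trans c cw.
Qed.

End CechClasses.

(** * Cocycles of extensions *)

Section LocalMorphisms.
Variables (K : closedFieldType) (X : kspace K).
Implicit Types (A B C : omodule X) (U V W : opens X).

Section Linear.
Variables (A B : omodule X) (U : opens X) (f : A U -> B U).
Hypothesis f_lin : forall (a : reg U) m n, f (a *: m + n) = a *: f m + f n.

Lemma lin0 : f 0 = 0.
Proof.
by have := f_lin (-1) 0 0; rewrite !scaleN1r oppr0 addr0 addNr.
Qed.

Lemma linB m n : f (m - n) = f m - f n.
Proof. by have := f_lin (-1) n m; rewrite !scaleN1r ![- _ + _]addrC. Qed.

Lemma linZ a m : f (a *: m) = a *: f m.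
Proof. by have := f_lin a m 0; rewrite !addr0 lin0 addr0. Qed.

End Linear.

Definition lochom_of_omor A B (f : omor A B) U : lochom A B U :=
  @LocHom _ _ A B U (fun V _ => f V) (fun V _ => @om_linear _ _ _ _ f V)
    (fun V W _ k _ m => om_res f k m).

Program Definition lochom_comp A B C U (g : lochom B C U) (f : lochom A B U) :
    lochom A C U :=
  @LocHom _ _ A C U (fun V h m => g V h (f V h m)) _ _.
Next Obligation. by move=> A B C U g f V h a m n /=; rewrite !lh_linear. Qed.
Next Obligation.
by move=> A B C U g f V W h k h' m /=; rewrite (lh_res g h k h') (lh_res f h k h').
Qed.

Definition lochom_id A U : lochom A A U :=
  @LocHom _ _ A A U (fun _ _ m => m) (fun _ _ _ _ _ => erefl)
    (fun _ _ _ _ _ _ => erefl).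

Lemma lochom_congr A B U (f g : lochom A B U) V (h : V `<=` U) m :
  f = g -> f V h m = g V h m.
Proof. by move=> ->. Qed.

End LocalMorphisms.

Section ExactSequences.
Variables (K : closedFieldType) (X : kspace K) (F E G : omodule X).
Variables (i : omor F E) (p : omor E G).
Hypothesis ex : short_exact i p.
Implicit Types (U V W : opens X).

Lemma short_exact_inj U (m n : F U) : i U m = i U n -> m = n.
Proof.
case: ex => inj _ _ _ e; apply/eqP; rewrite -subr_eq0; apply/eqP/inj.
by rewrite (linB (@om_linear _ _ _ _ i U)) e subrr.
Qed.

(** Exactness in the middle is a local condition, but F is the sheaf kernel of p:
    local preimages are unique, hence glue. *)
Lemma short_exact_ker U (n : E U) : p U n = 0 -> exists m, i U m = n.
Proof.
case: (ex) => _ _ loc _ pn.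
pose P (V : opens X) (m : F V) := forall h : V `<=` U, i V m = mres h n.
have [||x Ux|t ht] := @mres_glue K X F U P.
- move=> V W k m h Pm hW.
  by rewrite -om_res (Pm h) (@mres_comp _ _ E _ _ _ _ _ hW).
- by move=> V m m' h Pm Pm'; apply: short_exact_inj; rewrite (Pm h) (Pm' h).
- have [V [h [m [Vx e]]]] := loc U n pn x Ux.
  by exists V; split=> //; exists m => h'; rewrite e; exact: mres_irr.
exists t; apply: mres_loc_eq => x Ux.
have [V [h [m [Vx e]]]] := loc U n pn x Ux.
exists V, h; split=> //; rewrite om_res (ht V h m) //.
by move=> h'; rewrite e; exact: mres_irr.
Qed.

Lemma short_exact_ker_lochom (H : omodule X) U (f : lochom H E U) :
  (forall V (h : V `<=` U) m, p V (f V h m) = 0) ->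
  exists g : lochom H F U, forall V (h : V `<=` U) m, i V (g V h m) = f V h m.
Proof.
move=> pf; pose g V h m := sval (cid (short_exact_ker (pf V h m))).
have gP V h m : i V (g V h m) = f V h m by rewrite /g; case: cid.
unshelve eexists (@LocHom _ _ H F U g _ _) => //.
- by move=> V h a m n; apply: short_exact_inj; rewrite om_linear !gP lh_linear.
- move=> V W h k hW m; apply: short_exact_inj.
  by rewrite -om_res !gP (lh_res f h k hW).
Qed.

End ExactSequences.

(** After transport along phi the two families of splittings are splittings of the
    same extension over a common refinement; their differences s' - phi s take
    values in F, and form the cochain whose coboundary is z' - z. *)
Lemma splitting_cocycle_unique (K : closedFieldType) (X : kspace K)
    (G F : omodule X) (E E' : extension G F) (z z' : cocycle (sheafHom G F)) :
  ext_equiv E E' -> splitting_cocycle E z -> splitting_cocycle E' z' ->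
  cohomologous z z'.
Proof.
move=> [phi [_ phi_i phi_p]] [s [s_split sz]] [s' [s'_split sz']].
pose O (k : cidx z * cidx z') := opensI (z k.1) (z' k.2).
have hl k : O k `<=` z k.1 := @opensIl _ _ _.
have hr k : O k `<=` z' k.2 := @opensIr _ _ _.
pose q k : lochom G (emid E') (O k) := lochom_res_fun (hr k) (s' k.2) -
  lochom_comp (lochom_of_omor phi (O k)) (lochom_res_fun (hl k) (s k.1)).
have qE k (V : opens X) (h : V `<=` O k) h1 h2 m :
    q k V h m = s' k.2 V h1 m - phi V (s k.1 V h2 m).
  rewrite (Prop_irrelevance h1 (subset_trans h (hr k))).
  by rewrite (Prop_irrelevance h2 (subset_trans h (hl k))).
have hex k : exists g : lochom G F (O k),
    forall (V : opens X) (k' : V `<=` O k) m, einj E' V (g V k' m) = q k V k' m.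
  apply: (short_exact_ker_lochom (e_exact E')) => V k' m.
  rewrite (qE k V k' (subset_trans k' (hr k)) (subset_trans k' (hl k))).
  by rewrite (linB (@om_linear _ _ _ _ (eprj E') V)) phi_p s_split s'_split subrr.
pose h k := sval (cid (hex k)).
have hP k V k' m : einj E' V (h k V k' m) = q k V k' m by rewrite /h; case: cid.
exists (coverI (cov z) (cov z')), fst, snd, h; split=> [k|k|k l e e' ek el].
- exact: hl.
- exact: hr.
apply: lochomP => V hV m /=.
apply: (short_exact_inj (e_exact E')).
have [k1 k2] := (subset_trans (subset_trans hV ek) (hl k),
                 subset_trans (subset_trans hV ek) (hr k)).
have [l1 l2] := (subset_trans (subset_trans hV el) (hl l),
                 subset_trans (subset_trans hV el) (hr l)).
have om_B := linB (@om_linear _ _ _ _ (einj E') V).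
have phi_B := linB (@om_linear _ _ _ _ phi V).
rewrite !om_B !hP (qE k _ _ k2 k1) (qE l _ _ l2 l1).
rewrite (sz' _ _ _ _ k2 l2) -phi_i (sz _ _ _ _ k1 l1) phi_B.
by rewrite !opprB addrACA [in RHS]addrACA [- phi _ _ + _]addrC.
Qed.

(** * The sequence of tau-differentials and the Kodaira-Spencer class *)

Section KodairaSpencer.
Variables (K : closedFieldType) (delta : K -> K) (e : K).
Hypothesis hdelta : derivation delta.
Hypothesis he : delta e = 1.
Variable X : kspace K.
Hypothesis schX : is_scheme X.
Hypothesis intX : integral_scheme X.
Hypothesis smoothX : smooth_scheme X.
Implicit Types U V W : opens X.

Definition operator_family U := forall V, V `<=` U -> reg V -> reg V.

(** Derivations of the sheaf of rings on U that extend delta, as compatible families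
    of derivations of the O(V), V contained in U. *)
Definition derivation_family U (E : operator_family U) : Prop :=
  (forall V (h : V `<=` U), extends_delta delta (E V h)) /\
  (forall V W (h : V `<=` U) (k : W `<=` V) (hW : W `<=` U) r,
     ores k (E V h r) = E W hW (ores k r)).

Definition family_res U V (k : V `<=` U) (E : operator_family U) :
  operator_family V := fun W h => E W (subset_trans h k).

Lemma derivation_family_res U V (k : V `<=` U) (E : operator_family U) :
  derivation_family E -> derivation_family (family_res k E).
Proof.
by move=> [Ed Er]; split=> [W h|W W' h l hW r]; [exact: Ed | exact: Er].
Qed.

Lemma family_resE U V (k : V `<=` U) (E : operator_family U) W (h : W `<=` V)
  (h' : W `<=` U) r : family_res k E h r = E W h' r.
Proof. by rewrite /family_res (Prop_irrelevance (subset_trans h k) h'). Qed.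

Lemma derivation_family_of U (D : reg U -> reg U) :
  affine U -> extends_delta delta D ->
  exists2 E : operator_family U, derivation_family E &
    (forall V (h : V `<=` U) r, E V h (ores h r) = ores h (D r)) /\
    forall V (h : V `<=` U) (D' : reg V -> reg V), derivation D' ->
        (forall r, D' (ores h r) = ores h (D r)) -> forall r, D' r = E V h r.
Proof.
move=> aU [dD Dc]; have [E [Ed Er ED Eu]] := derivation_spread schX intX aU dD.
exists E => //; split=> // V h; split=> // a.
by rewrite -(ores_cst h) ED Dc ores_cst.
Qed.

(** [smooth_derivation] on a standard smooth affine neighbourhood, followed by
    [derivation_spread]. *)
Lemma smooth_point x : exists U (E : operator_family U) (D : reg U -> reg U),
  [/\ U x, affine U, derivation_family E, extends_delta delta D &
      forall V (h : V `<=` U) r, E V h (ores h r) = ores h (D r)].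
Proof.
have [U Ux [aU sU]] := smoothX x.
have [D dD Dc] := smooth_derivation (reg_one_neq0 intX Ux) hdelta sU.
have [E dE [ED _]] := derivation_family_of aU (conj dD Dc).
by exists U, E, D; split.
Qed.

Variables (Om : omodule X) (d : forall U, reg U -> Om U).
Hypothesis hd : is_Omega d.
Variables (Omt : omodule X) (tau : forall U, reg U -> Omt U).
Hypothesis htau : is_Omega_tau delta tau.

Lemma d_cst U a : d (kcst U a) = 0.
Proof.
apply: mres_loc_eq => x Ux; have [V [aV h Vx]] := affine_base schX Ux.
exists V, h; split=> //; rewrite raddf0 hd.1 ores_cst.
by have [_ _] := presented_kahler (hd.2 V aV).
Qed.

(** Taking e as one of the two constants in the relation
    delta(a) tau b = delta(b) tau a shows that constants contribute only
    multiples of tau e. *)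
Lemma tau_cst V a : affine V ->
  tau (kcst V a) = kcst V (delta a) *: tau (kcst V e).
Proof.
move=> aV; have [_ _ /(_ e a)] := presented_tau (htau.2 V aV).
by rewrite he rmorph1 scale1r.
Qed.

Definition tau_incl : omor (omod1 X) Omt.
Proof.
apply: (@OMor _ _ (omod1 X) Omt (fun U (f : reg U) => f *: tau (kcst U e))).
  by move=> U a m n; rewrite scalerDl scalerA.
by move=> U V h m; rewrite mres_scale htau.1 ores_cst.
Defined.

Lemma tau_proj_ex : exists p : omor Omt Om, forall U r, p U (tau r) = d r.
Proof.
pose top : opens X := Opens openT.
have [||f ft] := @lochom_lift K X Omt tau (fun V => tau_rel (kcst V) delta)
    schX htau.1 htau.2 Om top (fun V _ => @d V).
- by move=> V W _ h _ r; exact: hd.1.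
- move=> V _ aV; have [dD dM dc] := presented_kahler (hd.2 V aV).
  by apply: tau_rel_kill => // a b; rewrite !dc !scaler0.
have sT V : V `<=` top by [].
exists (@OMor _ _ Omt Om (fun U => f U (sT U)) (fun U => lh_linear f (sT U))
  (fun U V h m => lh_res f (sT U) h (sT V) m)) => U r.
exact: ft.
Qed.

(** The difference of two extensions of delta kills K, hence factors through d. *)
Lemma derivation_difference U (E E' : operator_family U) :
  derivation_family E -> derivation_family E' ->
  exists kap : lochom Om (omod1 X) U, forall V (h : V `<=` U) r,
    kap V h (d r) = E V h r - E' V h r.
Proof.
move=> [Ed Er] [E'd E'r].
apply: (@lochom_lift K X Om d (fun V => kahler_rel (kcst V)) schX hd.1 hd.2
  (omod1 X) U (fun V h r => (E V h r - E' V h r : omod1 X V))).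
- by move=> V W h k hW r; rewrite -Er -E'r /=; exact: rmorphB.
- move=> V h aV.
  have [[[ED EM] Ec] [[E'D E'M] E'c]] := (Ed V h, E'd V h).
  apply: kahler_rel_kill => [r s|r s|a].
  + by rewrite ED E'D opprD addrACA.
  + rewrite EM E'M; change (r * E V h s + s * E V h r - (r * E' V h s + s * E' V h r)
      = r * (E V h s - E' V h s) + s * (E V h r - E' V h r)); ring.
  + by rewrite Ec E'c subrr.
Qed.

Section LocalSplitting.
Variables (U : opens X) (E : operator_family U).
Hypothesis dE : derivation_family E.

(** The module of tau-differentials represents the derivations D whose restriction
    to K is proportional to delta, such as those extending delta:
    delta(a) D(b) = delta(a) delta(b) is symmetric in a and b. *)
Lemma tau_retraction : exists lam : lochom Omt (omod1 X) U,
  forall V (h : V `<=` U) r, lam V h (tau r) = E h r.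
Proof.
have [Ed Er] := dE.
apply: (@lochom_lift K X Omt tau (fun V => tau_rel (kcst V) delta)
    schX htau.1 htau.2 (omod1 X) U E) => // V h aV.
have [[ED EM] Ec] := Ed V h.
by apply: tau_rel_kill => // a b; rewrite !Ec; exact: mulrC.
Qed.

(** The map r |-> tau r - D(r) tau e is a derivation, and it kills K because
    tau a = delta(a) tau e. *)
Lemma tau_section : exists s : lochom Om Omt U,
  forall V (h : V `<=` U) r, s V h (d r) = tau r - E h r *: tau (kcst V e).
Proof.
have [Ed Er] := dE.
apply: (@lochom_lift K X Om d (fun V => kahler_rel (kcst V)) schX hd.1 hd.2
  Omt U (fun V h r => tau r - E h r *: tau (kcst V e))).
- move=> V W h k hW r.
  by rewrite raddfB /= mres_scale !htau.1 ores_cst (Er V W h k hW).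
- move=> V h aV.
  have [[ED EM] Ec] := Ed V h.
  have [tD tM _] := presented_tau (htau.2 V aV).
  apply: kahler_rel_kill => [r s|r s|a].
  + by rewrite tD ED scalerDl opprD addrACA.
  + rewrite tM EM scalerDl !scalerBr !scalerA opprD addrACA.
    by [].
  + by rewrite tau_cst // Ec subrr.
Qed.

Variables (p : omor Omt Om).
Hypothesis p_tau : forall U r, p U (tau r) = d r.
Variable s : lochom Om Omt U.
Hypothesis s_d : forall V (h : V `<=` U) r,
  s V h (d r) = tau r - E h r *: tau (kcst V e).

Lemma tau_sectionK V (h : V `<=` U) m : p V (s V h m) = m.
Proof.
have -> : p V (s V h m) =
  lochom_comp (lochom_of_omor p U) s V h m by [].
rewrite (_ : lochom_comp _ _ = lochom_id Om U) //.
apply: (lochom_ext schX hd.2) => W k r /=.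
rewrite s_d (linB (@om_linear _ _ _ _ p W)) (linZ (@om_linear _ _ _ _ p W)).
by rewrite !p_tau d_cst scaler0 subr0.
Qed.

Variable lam : lochom Omt (omod1 X) U.
Hypothesis lam_tau : forall V (h : V `<=` U) r, lam V h (tau r) = E h r.

(** Together with [tau_sectionK] and [tau_inclK]: a derivation extending delta
    splits the sequence over U. *)
Lemma tau_decomposition V (h : V `<=` U) m :
  tau_incl V (lam V h m) + s V h (p V m) = m.
Proof.
have -> : tau_incl V (lam V h m) + s V h (p V m) =
  (lochom_comp (lochom_of_omor tau_incl U) lam +
   lochom_comp s (lochom_of_omor p U)) V h m by [].
rewrite (_ : _ + _ = lochom_id Omt U) //.
apply: (lochom_ext schX htau.2) => W k r /=.
by rewrite lam_tau p_tau s_d addrC subrK.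
Qed.

Lemma tau_inclK V (h : V `<=` U) (f : reg V) : lam V h (tau_incl V f) = f.
Proof.
have [Ed _] := dE; have [_ Ec] := Ed V h.
rewrite /= (linZ (@lh_linear _ _ _ _ _ lam V h)) lam_tau Ec he rmorph1.
exact: mulr1.
Qed.

End LocalSplitting.

(** Exactness is local, and locally there are derivations extending delta, hence
    splittings. *)
Lemma tau_short_exact (p : omor Omt Om) :
  (forall U r, p U (tau r) = d r) -> short_exact tau_incl p.
Proof.
move=> p_tau; split.
- move=> U f f0; apply: mres_loc_eq => x Ux.
  have [A [E [D [Ax _ dE _ _]]]] := smooth_point x.
  have [lam lamP] := tau_retraction dE.
  exists (opensI U A), (@opensIl _ U A); split; first by split.
  rewrite -[LHS](tau_inclK dE lamP (@opensIr _ U A)) -om_res f0 !raddf0.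
  exact: (lin0 (@lh_linear _ _ _ _ _ lam _ _)).
- move=> U f /=.
  by rewrite (linZ (@om_linear _ _ _ _ p U)) p_tau d_cst scaler0.
- move=> U n pn x Ux.
  have [A [E [D [Ax _ dE _ _]]]] := smooth_point x.
  have [lam lamP] := tau_retraction dE; have [s sP] := tau_section dE.
  have h := @opensIl _ U A.
  exists (opensI U A), h, (lam _ (@opensIr _ U A) (mres h n)).
  split; first by split.
  rewrite -[RHS](tau_decomposition p_tau sP lamP (@opensIr _ U A)).
  rewrite -[p _ _](om_res p h) pn raddf0.
  by rewrite (lin0 (@lh_linear _ _ _ _ _ s _ _)) addr0.
- move=> U q x Ux.
  have [A [E [D [Ax _ dE _ _]]]] := smooth_point x.
  have [s sP] := tau_section dE.
  exists (opensI U A), (@opensIl _ U A), (s _ (@opensIr _ U A) (mres (@opensIl _ U A) q)).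
  by split; [split | exact: (tau_sectionK p_tau sP)].
Qed.

Definition difference_cocycle (z : cocycle (dual_sheaf Om))
    (E : forall i, operator_family (z i)) : Prop :=
  forall i j V (h : V `<=` opensI (z i) (z j)) (hi : V `<=` z i) (hj : V `<=` z j) r,
    (coch i j : lochom Om (omod1 X) _) V h (d r) = E i V hi r - E j V hj r.

(** The derivations of the two families differ by K-linear ones on a common
    refinement, and these differences form the required cochain. *)
Lemma difference_cocycle_unique z E z' E' :
  (forall i, derivation_family (E i)) -> (forall i, derivation_family (E' i)) ->
  @difference_cocycle z E -> @difference_cocycle z' E' -> cohomologous z z'.
Proof.
move=> dE dE' zE zE'.
pose O (k : cidx z * cidx z') := opensI (z k.1) (z' k.2).
have hl k : O k `<=` z k.1 := @opensIl _ _ _.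
have hr k : O k `<=` z' k.2 := @opensIr _ _ _.
have hex k := derivation_difference
  (derivation_family_res (hl k) (dE k.1)) (derivation_family_res (hr k) (dE' k.2)).
pose h k := sval (cid (hex k)).
have hP k V (k' : V `<=` O k) (k1 : V `<=` z k.1) (k2 : V `<=` z' k.2) r :
    h k V k' (d r) = E k.1 V k1 r - E' k.2 V k2 r.
  by rewrite -(family_resE (hl k) _ k') -(family_resE (hr k) _ k') /h; case: cid.
exists (coverI (cov z) (cov z')), fst, snd, h; split=> [k|k|k l e1 e2 ek el].
- exact: hl.
- exact: hr.
apply: (lochom_ext schX hd.2) => V hV r /=.
have k1 := subset_trans (subset_trans hV ek) (hl k).
have k2 := subset_trans (subset_trans hV ek) (hr k).
have l1 := subset_trans (subset_trans hV el) (hl l).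
have l2 := subset_trans (subset_trans hV el) (hr l).
rewrite (hP k _ _ k1 k2) (hP l _ _ l1 l2) (zE' _ _ _ _ k2 l2) (zE _ _ _ _ k1 l1).
by rewrite !opprB [LHS]addrC addrACA [RHS]addrACA; congr (_ + _); exact: addrC.
Qed.

(** A Kodaira-Spencer cocycle is given by derivations on the members of the cover
    alone, but these have unique restrictions to smaller open sets. *)
Lemma Kodaira_Spencer_difference z : Kodaira_Spencer_cocycle delta d z ->
  exists2 E : forall i, operator_family (z i),
    forall i, derivation_family (E i) & difference_cocycle E.
Proof.
move=> [az [D dD zD]].
have Eex i := derivation_family_of (az i) (dD i).
pose E i := s2val (cid2 (Eex i)).
exists E => [i|i j V h hi hj r]; first by rewrite /E; case: cid2.
have [Di [Dj [[[dDi _] eDi] [[dDj _] eDj] ->]]] := zD i j V h hi hj.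
have Eu k (hk : V `<=` z k) (D' : reg V -> reg V) : derivation D' ->
    (forall r, D' (ores hk r) = ores hk (D k r)) -> D' r = E k V hk r.
  by move=> dD' eD'; rewrite /E; case: cid2 => Ek /= _ [_ Eku]; exact: Eku.
by rewrite (Eu i hi Di) // (Eu j hj Dj).
Qed.

(** A cover of X, indexed by its points, by smooth affine opens with a chosen
    derivation. *)
Definition smooth_patch x := cid (smooth_point x).
Definition smooth_patch_set x : opens X := sval (smooth_patch x).
Definition smooth_patch_data x := cid (svalP (smooth_patch x)).
Definition smooth_patch_family x : operator_family (smooth_patch_set x) :=
  sval (smooth_patch_data x).
Definition smooth_patch_der x : reg (smooth_patch_set x) -> reg (smooth_patch_set x) :=
  sval (cid (svalP (smooth_patch_data x))).

Arguments smooth_patch_family : clear implicits.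

Lemma smooth_patchP x : [/\ smooth_patch_set x x, affine (smooth_patch_set x),
  derivation_family (smooth_patch_family x), extends_delta delta (@smooth_patch_der x) &
  forall V (h : V `<=` smooth_patch_set x) r,
    smooth_patch_family x V h (ores h r) = ores h (smooth_patch_der r)].
Proof. exact: (svalP (cid (svalP (smooth_patch_data x)))). Qed.

Definition smooth_patch_cover : open_cover X.
Proof.
apply: (@Cover X X smooth_patch_set) => x; exists x.
by have [] := smooth_patchP x.
Defined.

Lemma smooth_patch_difference_ex x y :
  exists kap : lochom Om (omod1 X) (opensI (smooth_patch_set x) (smooth_patch_set y)),
    forall V (h : V `<=` opensI (smooth_patch_set x) (smooth_patch_set y)) r,
    kap V h (d r) = family_res (@opensIl _ _ _) (smooth_patch_family x) h r -
                    family_res (@opensIr _ _ _) (smooth_patch_family y) h r.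
Proof.
have [_ _ dx _ _] := smooth_patchP x; have [_ _ dy _ _] := smooth_patchP y.
by apply: derivation_difference; exact: derivation_family_res.
Qed.

Definition smooth_patch_difference x y := sval (cid (smooth_patch_difference_ex x y)).

Lemma smooth_patch_differenceE x y V
    (h : V `<=` opensI (smooth_patch_set x) (smooth_patch_set y))
    (hx : V `<=` smooth_patch_set x) (hy : V `<=` smooth_patch_set y) r :
  smooth_patch_difference x y V h (d r) =
    smooth_patch_family x V hx r - smooth_patch_family y V hy r.
Proof.
rewrite -(family_resE (@opensIl _ _ _) _ h) -(family_resE (@opensIr _ _ _) _ h).
by rewrite /smooth_patch_difference; case: cid.
Qed.

Lemma smooth_patch_difference_cocycle (i j k : cidx smooth_patch_cover) W
    (hij : W `<=` opensI (smooth_patch_cover i) (smooth_patch_cover j))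
    (hjk : W `<=` opensI (smooth_patch_cover j) (smooth_patch_cover k))
    (hik : W `<=` opensI (smooth_patch_cover i) (smooth_patch_cover k)) :
  @ares _ (dual_sheaf Om) _ _ hij (smooth_patch_difference i j) +
  @ares _ (dual_sheaf Om) _ _ hjk (smooth_patch_difference j k) =
  @ares _ (dual_sheaf Om) _ _ hik (smooth_patch_difference i k).
Proof.
apply: (lochom_ext schX hd.2) => V hV r /=.
have hi : V `<=` smooth_patch_set i by move=> x /hV/hij[].
have hj : V `<=` smooth_patch_set j by move=> x /hV/hij[].
have hk : V `<=` smooth_patch_set k by move=> x /hV/hjk[].
by rewrite (smooth_patch_differenceE _ hi hj) (smooth_patch_differenceE _ hj hk)
   (smooth_patch_differenceE _ hi hk) subrKA.
Qed.

Definition smooth_patch_cocycle : cocycle (dual_sheaf Om) :=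
  @Cocycle X (dual_sheaf Om) smooth_patch_cover smooth_patch_difference
    smooth_patch_difference_cocycle.

Lemma smooth_patch_cocycle_KS : Kodaira_Spencer_cocycle delta d smooth_patch_cocycle.
Proof.
split=> [i|]; first by have [] := smooth_patchP i.
exists smooth_patch_der => [i|i j V h hi hj]; first by have [] := smooth_patchP i.
have [_ _ [di _] _ ei] := smooth_patchP i; have [_ _ [dj _] _ ej] := smooth_patchP j.
exists (smooth_patch_family i V hi), (smooth_patch_family j V hj); split.
- by split; [exact: di | exact: ei].
- by split; [exact: dj | exact: ej].
- by move=> r; exact: smooth_patch_differenceE.
Qed.

(** The heart of the matter: the sections s_i (dr) = tau r - D_i(r) tau e satisfy
    (s_j - s_i)(dr) = (D_i - D_j)(r) tau e, so that the cocycle of the splittings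
    s_i is the cocycle of the differences of derivations, sign included. *)
Lemma smooth_patch_cocycle_splitting (p : omor Omt Om)
    (p_tau : forall U r, p U (tau r) = d r) :
  splitting_cocycle (Extension (tau_short_exact p_tau)) smooth_patch_cocycle.
Proof.
have dE i : derivation_family (smooth_patch_family i) by have [] := smooth_patchP i.
pose s i := sval (cid (tau_section (dE i))).
have sP i V (h : V `<=` smooth_patch_set i) r :
    s i V h (d r) = tau r - smooth_patch_family i V h r *: tau (kcst V e).
  by rewrite /s; case: cid.
exists s; split=> [i V h m|i j V h hi hj m].
  exact: (tau_sectionK p_tau (sP i)).
have -> : s j V hj m - s i V hi m =
  (lochom_res_fun (@opensIr _ (smooth_patch_set i) (smooth_patch_set j)) (s j) -
   lochom_res_fun (@opensIl _ (smooth_patch_set i) (smooth_patch_set j)) (s i)) V h m.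
  by rewrite /=; congr (_ - _); [rewrite (Prop_irrelevance hj (subset_trans h (@opensIr _ _ _)))
    | rewrite (Prop_irrelevance hi (subset_trans h (@opensIl _ _ _)))].
rewrite -[LHS]/(lochom_comp (lochom_of_omor tau_incl _) (smooth_patch_difference i j) V h m).
apply: lochom_congr; apply: (lochom_ext schX hd.2) => W k r /=.
have ki : W `<=` smooth_patch_set i := subset_trans k (@opensIl _ _ _).
have kj : W `<=` smooth_patch_set j := subset_trans k (@opensIr _ _ _).
rewrite (smooth_patch_differenceE k ki kj) !sP.
rewrite (Prop_irrelevance (subset_trans k _) kj).
rewrite (Prop_irrelevance (subset_trans k _) ki).
by rewrite opprB [RHS]addrC subrKA scalerBl.
Qed.

End KodairaSpencer.

Theorem proposition3p17 (K : closedFieldType) (delta : K -> K)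
  (hdelta : derivation delta) (e : K) (he : delta e = 1)
  (X : kspace K) (hX : variety X) (hsm : smooth_scheme X)
  (Om : omodule X) (d : forall U : opens X, reg U -> Om U) (hd : is_Omega d)
  (Omt : omodule X) (tau : forall U : opens X, reg U -> Omt U)
  (htau : is_Omega_tau delta tau) :
  exists (i : omor (omod1 X) Omt) (p : omor Omt Om) (hex : short_exact i p),
    [/\ forall (U : opens X) (f : reg U), i U f = f *: tau U (kcst U e),
        forall (U : opens X) (f : reg U), p U (tau U f) = d U f &
        exists kappa : H1 (dual_sheaf Om),
          (forall k, Ext1_to_H1 (Ext1_class (Extension hex)) k <-> k = kappa) /\
          (forall k, is_Kodaira_Spencer_class delta d k <-> k = kappa)].
Proof.
have [schX intX _ _] := hX.
have [p p_tau] := tau_proj_ex schX hd htau.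
pose hex := tau_short_exact hdelta he schX intX hsm hd htau p_tau.
pose z := smooth_patch_cocycle hdelta schX intX hsm hd.
have zs : splitting_cocycle (Extension hex) z by exact: smooth_patch_cocycle_splitting.
have zKS : Kodaira_Spencer_cocycle delta d z by exact: smooth_patch_cocycle_KS.
exists (tau_incl e htau), p, hex; split=> //.
exists (H1_class z); split=> k; split.
- move=> [E [z' [eE sE ->]]]; apply: H1_class_eq; apply: cohomologous_sym.
  exact: splitting_cocycle_unique eE zs sE.
- move=> ->; exists (Extension hex), z; split=> //=.
  unshelve eexists (@OMor _ _ Omt Omt (fun _ m => m) _ _) => //.
  by split=> // U; exists id.
- move=> [z' zKS' ->]; apply: H1_class_eq.
  have [E dE zE] := Kodaira_Spencer_difference schX intX zKS.
  have [E' dE' zE'] := Kodaira_Spencer_difference schX intX zKS'.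
  exact: difference_cocycle_unique dE' dE zE' zE.
- by move=> ->; exists z.
Qed.
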